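(* Let $G$ be a countable sofic group, let $L$ be a finite set, and let $f_0:L\to\mathbb{R}$ be a function. Consider the shift space $L^G$ and define $f:L^G\to\mathbb{R}$ by $f(x)=f_0(x(1_G))$. Define a probability measure $\lambda$ on $L$ by $$\lambda(\ell)=\frac{\exp(f_0(\ell))}{\sum_{\ell'\in L}\exp(f_0(\ell'))}.$$ Then $\lambda^G$ is the unique equilibrium state for $f$ for every sofic approximation $\Sigma$ to $G$.
   Context: $L^G$ has the product topology and the action $(g\cdot x)(h)=x(g^{-1}h)$. A sofic approximation to $G$ is a sequence $\Sigma = (\sigma_i : G\to \mathrm{Sym}(d_i))_{i\in\mathbb{N}}$ of maps with $d_i\to\infty$ such that for all $g,h\in G$, $\frac{1}{d_i}|\{a : \sigma_i(gh)(a) = \sigma_i(g)\sigma_i(h)(a)\}|\to 1$, and for all $g\ne h$, $\frac{1}{d_i}|\{a : \sigma_i(g)(a)\neq\sigma_i(h)(a)\}|\to 1$; $G$ is sofic if one exists. Let $G$ act by homeomorphisms on a compact metrizable space $X$ with compatible metric $\rho$. For $\varphi,\psi:\{1,\dots,d\}\to X$ put $\rho_2(\varphi,\psi) = (\frac1d\sum_a \rho(\varphi(a),\psi(a))^2)^{1/2}$ and $\rho_\infty(\varphi,\psi)=\max_a\rho(\varphi(a),\psi(a))$. For finite $F\subseteq G$, $\delta>0$ and $\sigma:G\to\mathrm{Sym}(d)$, let $\mathrm{Map}(\rho,F,\delta,\sigma)$ be the set of $\varphi:\{1,\dots,d\}\to X$ with $\rho_2(\varphi\circ\sigma(s),s\cdot\varphi)<\delta$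 for all $s\in F$. Sofic pressure of a continuous $f:X\to\mathbb{R}$: $$P_\Sigma(f,X,G)=\sup_{\epsilon>0}\inf_F\inf_{\delta>0}\limsup_{i\to\infty}\frac1{d_i}\log\Big(\sup_{\mathcal{E}}\sum_{\varphi\in\mathcal{E}}\exp\Big(\sum_{a=1}^{d_i}f(\varphi(a))\Big)\Big),$$ where $\mathcal{E}$ ranges over subsets of $\mathrm{Map}(\rho,F,\delta,\sigma_i)$ that are $\epsilon$-separated with respect to $\rho_\infty$ (and $\log 0=-\infty$). Sofic measure entropy of a $G$-invariant Borel probability measure $\mu$ on $X$: for finite $E\subseteq C(X)$ let $\mathrm{Map}_\mu(\rho,F,E,\delta,\sigma)$ be the set of $\varphi\in\mathrm{Map}(\rho,F,\delta,\sigma)$ with $|\frac1d\sum_a u(\varphi(a))-\int u\,d\mu|<\delta$ for all $u\in E$, and let $N_\epsilon(\cdot,\rho_\infty)$ be the maximal cardinality of an $\epsilon$-separated subset for $\rho_\infty$. Then $$h^\Sigma_G(X,\mu)=\sup_{\epsilon>0}\inf_F\inf_E\inf_{\delta>0}\limsup_{i\to\infty}\frac1{d_i}\log N_\epsilon(\mathrm{Map}_\mu(\rho,F,E,\delta,\sigma_i),\rho_\infty).$$ Both quantities are independent of $\rho$. A $G$-invariant Borel probability measure $\mu$ on $X$ is an equilibrium state for $f$ (and $\Sigma$) if $P_\Sigma(f,X,G)=h^\Sigma_G(X,\mu)+\int f\,d\mu$. *)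

(* Defs.v *)
From HB Require Import structures.
From mathcomp Require Import all_boot all_order all_algebra all_fingroup finmap.
From mathcomp Require Import all_classical all_reals all_analysis.

Set Implicit Arguments.
Unset Strict Implicit.
Unset Printing Implicit Defensive.

Import Order.TTheory GRing.Theory Num.Theory.
Import numFieldNormedType.Exports.

Local Open Scope classical_set_scope.
Local Open Scope ring_scope.

(* Nonempty finite sets.  Measurable types are pointed in the library, hence
   the base point; nothing below depends on which point is chosen. *)
#[short(type="finPointedType")]
HB.structure Definition FinPointed := {T of Finite T & Pointed T}.

Notation borel X := (g_sigma_algebraType (@open X)).

(* In MathComp [(s * t)%g a = t (s a)] for permutations, so the composition
   sigma_i(g) sigma_i(h) is written out. *)
Record sofic_approximation (R : realType) (G : groupType) := SoficApproximation {
  sdim : nat -> nat;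
  smap : forall i, G -> {perm 'I_(sdim i)};
  sdim_infty : sdim i @[i --> \oo] --> \oo;
  smap_mul : forall g h : G,
    (#|[pred a | smap i (g * h)%g a == smap i g (smap i h a)]|%:R
       / (sdim i)%:R : R) @[i --> \oo] --> (1 : R);
  smap_free : forall g h : G, g != h ->
    (#|[pred a | smap i g a != smap i h a]|%:R
       / (sdim i)%:R : R) @[i --> \oo] --> (1 : R)
}.

Definition sofic (R : realType) (G : groupType) : Prop :=
  inhabited (sofic_approximation R G).

Definition compatible_metric (R : realType) (X : topologicalType)
    (rho : X -> X -> R) : Prop :=
  [/\ forall x y, 0 <= rho x y,
      forall x y, rho x y = 0 <-> x = y,
      forall x y, rho x y = rho y x,
      forall x y z, rho x z <= rho x y + rho y z
    & forall x (A : set X),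
        nbhs x A <-> exists2 e : R, 0 < e & [set y | rho x y < e] `<=` A].

Section SoficThermodynamics.
Variables (R : realType) (G : groupType) (X : ptopologicalType).
Variables (act : G -> X -> X) (rho : X -> X -> R).

Definition rho2 d (phi psi : 'I_d -> X) : R :=
  Num.sqrt (d%:R^-1 * \sum_(a < d) rho (phi a) (psi a) ^+ 2).

Definition rho_infty d (phi psi : 'I_d -> X) : R :=
  \big[Num.max/0]_(a < d) rho (phi a) (psi a).

Definition eps_separated d (eps : R) (E : set ('I_d -> X)) : Prop :=
  forall phi psi, E phi -> E psi -> phi <> psi -> eps <= rho_infty phi psi.

Definition Map (F : {fset G}) (delta : R) d (sigma : G -> {perm 'I_d}) :
    set ('I_d -> X) :=
  [set phi : 'I_d -> X | forall s, s \in F ->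
     rho2 (phi \o sigma s) (act s \o phi) < delta].

Definition Map_mu (mu : probability (borel X) R) (F : {fset G})
    (E : {fset X -> R}) (delta : R) d (sigma : G -> {perm 'I_d}) :
    set ('I_d -> X) :=
  Map F delta sigma `&`
  [set phi : 'I_d -> X | forall u, u \in E ->
     `|d%:R^-1 * \sum_(a < d) u (phi a) - \int[mu]_x u x| < delta].

Variable Sigma : sofic_approximation R G.

(* [\esum] is the sum in the extended reals over an arbitrary index set, and
   [lne 0 = -oo]. *)
Definition sofic_pressure (f : X -> R) : \bar R :=
  ereal_sup [set
    ereal_inf [set
      ereal_inf [set
        limn_esup (fun i => ((sdim Sigma i)%:R^-1)%:E *
          lne (ereal_sup
            [set (\esum_(phi in E)
                    (expR (\sum_(a < sdim Sigma i) f (phi a)))%:E)%E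
            | E in [set E | E `<=` Map F delta (smap Sigma i)
                            /\ eps_separated eps E]]))%E
      | delta in [set delta : R | 0 < delta]]
    | F in [set: {fset G}]]
  | eps in [set eps : R | 0 < eps]].

Definition max_separated d (eps : R) (M : set ('I_d -> X)) : \bar R :=
  ereal_sup [set counting E
            | E in [set E | E `<=` M /\ eps_separated eps E]].

Definition sofic_entropy (mu : probability (borel X) R) : \bar R :=
  ereal_sup [set
    ereal_inf [set
      ereal_inf [set
        ereal_inf [set
          limn_esup (fun i => ((sdim Sigma i)%:R^-1)%:E *
            lne (max_separated eps (Map_mu mu F E delta (smap Sigma i))))%E
        | delta in [set delta : R | 0 < delta]]
      | E in [set E : {fset X -> R} | forall u, u \in E -> continuous u]]
    | F in [set: {fset G}]]
  | eps in [set eps : R | 0 < eps]].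

Definition invariant_measure (mu : probability (borel X) R) : Prop :=
  forall g (A : set (borel X)), measurable A -> mu (act g @^-1` A) = mu A.

Definition equilibrium_state (f : X -> R) (mu : probability (borel X) R) :
    Prop :=
  invariant_measure mu /\
  sofic_pressure f = (sofic_entropy mu + \int[mu]_x (f x)%:E)%E.

End SoficThermodynamics.

Definition shift_space (G : groupType) (L : finPointedType) : Type :=
  {ptws G -> discrete_topology L}.

HB.instance Definition _ (G : groupType) (L : finPointedType) :=
  Topological.copy (shift_space G L) {ptws G -> discrete_topology L}.
HB.instance Definition _ (G : groupType) (L : finPointedType) :=
  isPointed.Build (shift_space G L) (fun _ => point).

Definition shift_action (G : groupType) (L : finPointedType) (g : G)
    (x : shift_space G L) : shift_space G L :=
  fun h => x (g^-1 * h)%g.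

Section Gibbs.
Variables (R : realType) (L : finPointedType) (f0 : L -> R).

Definition gibbs_weight (l : L) : R :=
  expR (f0 l) / \sum_(l' : L) expR (f0 l').

Definition gibbs (A : set (borel (discrete_topology L))) : \bar R :=
  (\sum_(l : L)
    (gibbs_weight l)%:E * \d_(l : borel (discrete_topology L)) A)%E.

Let gibbs_weight_ge0 l : 0 <= gibbs_weight l.
Proof.
by rewrite divr_ge0 ?expR_ge0// sumr_ge0// => l' _; exact: expR_ge0.
Qed.

Let gibbs0 : gibbs set0 = 0%E.
Proof. by rewrite /gibbs big1// => l _; rewrite dirac0 mule0. Qed.

Let gibbs_ge0 A : (0 <= gibbs A)%E.
Proof.
by apply: sume_ge0 => l _; rewrite mule_ge0// lee_fin gibbs_weight_ge0.
Qed.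

Let gibbs_sigma_additive : semi_sigma_additive gibbs.
Proof.
move=> F mF tF mUF; rewrite [X in _ --> X](_ : _ =
    lim ((fun n => \sum_(0 <= i < n) gibbs (F i))%E @ \oo)).
  by apply: is_cvg_ereal_nneg_natsum => k _; exact: gibbs_ge0.
rewrite nneseries_sum//; last first.
  by move=> l i _; rewrite mule_ge0// lee_fin gibbs_weight_ge0.
apply: eq_bigr => l _; rewrite nneseriesZl//.
by congr (_ * _)%E; exact: measure_semi_bigcup.
Qed.

HB.instance Definition _ := isMeasure.Build _ _ _ gibbs
  gibbs0 gibbs_ge0 gibbs_sigma_additive.

Let gibbs_setT : gibbs setT = 1%E.
Proof.
rewrite /gibbs; under eq_bigr do rewrite diracT mule1.
rewrite sumEFin -mulr_suml divff// gt_eqF//.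
rewrite (bigD1 (point : L))//= ltr_pwDl ?expR_gt0//.
by apply: sumr_ge0 => l _; exact: expR_ge0.
Qed.

HB.instance Definition _ :=
  @Measure_isProbability.Build _ _ R gibbs gibbs_setT.

End Gibbs.

(* The library has no infinite products of measures; this is the defining
   property of [lambda^G]. *)
Definition is_product_power (R : realType) (G : groupType) (L : finPointedType)
    (lambda : probability (borel (discrete_topology L)) R)
    (nu : probability (borel (shift_space G L)) R) : Prop :=
  forall (F : {fset G}) (A : G -> set L),
    nu [set x : shift_space G L | forall g, g \in F -> A g (x g)] =
    (\prod_(g <- F) lambda (A g))%E.

(* Main.v *)
(* Write Z for the sum of the exp(f0 l) and p for the weights of lambda.  A
   microstate phi is determined, up to few errors, by the labelling
   psi(a) = phi(a)(1), because phi(a)(w) = psi(sigma(w^-1)(a)) at most sites a.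
   Penalizing each error by a small factor bounds weighted sums over separated
   sets of microstates by weighted sums over labellings; the weight
   exp(sum_a f0(psi(a))) sums to Z^d, hence the pressure is at most ln Z.
   Conversely every labelling psi yields the microstate
   a |-> (h |-> psi(sigma(h^-1)(a))), so the pressure equals ln Z, and by the law
   of large numbers under p^d the microstates of typical labellings show that
   the entropy of lambda^G is at least ln Z minus the integral of f.

   For uniqueness, tilt the weight by exp(s * sum_a g(window of psi at a)) for a
   local observable g.  The bounded differences inequality gives, for every
   invariant mu and all small s,
     h(mu) + int f dmu <= ln Z - s (int g dmu - int g dlambda^G) + C s^2,
   so that int g dmu = int g dlambda^G when mu is an equilibrium state.

   The measure lambda^G is the image of the Lebesgue measure on [0, 1) under
   the digits of an arithmetic code. *)

Require Import Defs.
From HB Require Import structures.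
From mathcomp Require Import all_boot all_order all_algebra all_fingroup finmap.
From mathcomp Require Import all_classical all_reals all_analysis.
From mathcomp Require Import ring lra.

Set Implicit Arguments.
Unset Strict Implicit.
Unset Printing Implicit Defensive.

Import Order.TTheory GRing.Theory Num.Theory.
Import numFieldNormedType.Exports.

Local Open Scope classical_set_scope.
Local Open Scope ring_scope.

(** * Bounded differences for product weights *)

Section ExpBounds.
Variable R : realType.
Implicit Types x : R.

(** Since [exp(-x) >= 1 - x], [exp x] is at most [1 / (1 - x)]; the remaining inequality
    [(1 + x + 2 x^2)(1 - x) >= 1] says [x^2 (1 - 2 x) >= 0]. *)
Lemma expR_le_quadratic x : `|x| <= 2^-1 -> expR x <= 1 + x + 2 * x ^+ 2.
Proof.
rewrite ler_norml => /andP[x1 x2].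
have y0 : 0 < 1 - x by lra.
have : expR x <= (1 - x)^-1.
  rewrite -[x in expR x]opprK expRN lef_pV2 ?posrE ?expR_gt0//.
  exact: expR_ge1Dx.
move/le_trans; apply; rewrite -div1r ler_pdivrMr//.
have : 0 <= x ^+ 2 * (1 - 2 * x) by rewrite mulr_ge0 ?sqr_ge0//; lra.
nra.
Qed.

End ExpBounds.

Section ProductExpectation.
Variables (R : realType) (L I : finType) (p : L -> R).
Hypotheses (p_ge0 : forall l, 0 <= p l) (p_sum1 : \sum_l p l = 1).
Implicit Types (psi : {ffun I -> L}) (h : {ffun I -> L} -> R).

Definition pweight psi : R := \prod_i p (psi i).

Definition expect h : R := \sum_psi pweight psi * h psi.

Definition upd psi b l : {ffun I -> L} := [ffun i => if i == b then l else psi i].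

(** Conditional expectation of [h] given all coordinates other than [b]. *)
Definition resample b h psi : R := \sum_l p l * h (upd psi b l).

Lemma pweight_ge0 psi : 0 <= pweight psi.
Proof. by apply: prodr_ge0. Qed.

Lemma expect_prod (v : I -> L -> R) :
  expect (fun psi => \prod_i v i (psi i)) = \prod_i \sum_l p l * v i l.
Proof.
rewrite bigA_distr_bigA; apply: eq_bigr => psi _.
by rewrite /pweight -big_split.
Qed.

Lemma expect_cst c : expect (fun=> c) = c.
Proof.
rewrite /expect -mulr_suml; suff -> : \sum_psi pweight psi = 1 by rewrite mul1r.
transitivity (expect (fun psi => \prod_(i : I) 1)).
  by apply: eq_bigr => psi _; rewrite big1// mulr1.
rewrite (expect_prod (fun _ _ => 1)) big1// => i _.
by under eq_bigr do rewrite mulr1.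
Qed.

Lemma eq_expect h h' : h =1 h' -> expect h = expect h'.
Proof. by move=> hh; apply: eq_bigr => psi _; rewrite hh. Qed.

Lemma le_expect h h' : (forall psi, h psi <= h' psi) -> expect h <= expect h'.
Proof. by move=> hh; apply: ler_sum => psi _; rewrite ler_wpM2l ?pweight_ge0. Qed.

Lemma expectD h h' : expect (fun psi => h psi + h' psi) = expect h + expect h'.
Proof. by rewrite -big_split/=; apply: eq_bigr => psi _; rewrite mulrDr. Qed.

Lemma expectZ c h : expect (fun psi => c * h psi) = c * expect h.
Proof. by rewrite mulr_sumr; apply: eq_bigr => psi _; rewrite mulrCA. Qed.

Lemma expect_sum (K : finType) (h : K -> {ffun I -> L} -> R) :
  expect (fun psi => \sum_k h k psi) = \sum_k expect (h k).
Proof. by rewrite exchange_big; apply: eq_bigr => psi _; rewrite mulr_sumr. Qed.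

(* The map [(psi, l) |-> (upd psi b l, psi b)] is a weight-preserving
   involution. *)
Lemma expect_resample b h : expect (resample b h) = expect h.
Proof.
pose T := fun u : {ffun I -> L} * L => (upd u.1 b u.2, u.1 b).
have TK : involutive T.
  move=> [psi l]; rewrite /T /=; congr pair; last by rewrite ffunE eqxx.
  by apply/ffunP => i; rewrite !ffunE; case: eqVneq => // ->.
have wT u : pweight (T u).1 * p (T u).2 = pweight u.1 * p u.2.
  case: u => psi l; rewrite /T /= /pweight (bigD1 b)//= [in RHS](bigD1 b)//=.
  rewrite ffunE eqxx (eq_bigr (fun i => p (psi i))); first by ring.
  by move=> i /negbTE ib; rewrite ffunE ib.
transitivity (\sum_u pweight u.1 * p u.2 * h (T u).1).
  rewrite -(pair_bigA _ (fun psi l => pweight psi * p l * h (upd psi b l)))/=.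
  by apply: eq_bigr => psi _; rewrite /resample mulr_sumr;
     apply: eq_bigr => l _; rewrite mulrA.
rewrite (reindex_inj (can_inj TK)).
under eq_bigr do rewrite TK wT.
rewrite -(pair_bigA _ (fun psi l => pweight psi * p l * h psi))/=.
apply: eq_bigr => psi _; rewrite -mulr_suml -mulr_sumr p_sum1.
by rewrite mulr1.
Qed.

Definition bounded_diff (c : R) h :=
  forall psi b l, `|h (upd psi b l) - h psi| <= c.

Lemma upd_comm psi b b' l l' : b != b' ->
  upd (upd psi b l) b' l' = upd (upd psi b' l') b l.
Proof.
move=> /negbTE bb'; apply/ffunP => i; rewrite !ffunE.
by have [->|//] := eqVneq i b'; rewrite eq_sym bb'.
Qed.

Lemma upd_upd psi b l l' : upd (upd psi b l) b l' = upd psi b l'.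
Proof. by apply/ffunP => i; rewrite !ffunE; case: eqP. Qed.

Lemma resample_upd b h psi l : resample b h (upd psi b l) = resample b h psi.
Proof. by apply: eq_bigr => l' _; rewrite upd_upd. Qed.

(** At [b' = b] the average no longer depends on the updated coordinate; at [b' != b] the two
    updates commute, so the bound passes to the average. *)
Lemma bounded_diff_resample c b h : 0 <= c ->
  bounded_diff c h -> bounded_diff c (resample b h).
Proof.
move=> c0 hc psi b' l.
have [->|bb'] := eqVneq b' b; first by rewrite resample_upd subrr normr0.
rewrite /resample -sumrB; apply: le_trans (ler_norm_sum _ _ _) _.
rewrite -[leRHS]mul1r -p_sum1 mulr_suml; apply: ler_sum => l' _.
rewrite -mulrBr normrM ger0_norm// ler_wpM2l//.
by rewrite upd_comm.
Qed.

(** [h] stays within [c] of its mean [m] over coordinate [b], so the quadratic bound for the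
    exponential applies to [h - m], and its linear term averages to zero. *)
Lemma resample_expR c b h psi : 0 <= c -> c <= 2^-1 -> bounded_diff c h ->
  resample b (fun psi => expR (h psi)) psi
  <= expR (2 * c ^+ 2) * expR (resample b h psi).
Proof.
move=> c0 c1 hc; set m := resample b h psi.
have hm l : `|h (upd psi b l) - m| <= c.
  have -> : h (upd psi b l) - m
      = \sum_l' p l' * (h (upd psi b l) - h (upd psi b l')).
    by under eq_bigr do rewrite mulrBr; rewrite sumrB -mulr_suml p_sum1 mul1r.
  apply: le_trans (ler_norm_sum _ _ _) _.
  rewrite -[leRHS]mul1r -p_sum1 mulr_suml; apply: ler_sum => l' _.
  rewrite normrM ger0_norm// ler_wpM2l//.
  by rewrite -(upd_upd psi b l' l).
have hl l : expR (h (upd psi b l))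
    <= expR m * (1 + (h (upd psi b l) - m) + 2 * c ^+ 2).
  rewrite -[X in expR X <= _](subrKC m) expRD ler_wpM2l ?expR_ge0//.
  apply: le_trans (expR_le_quadratic _) _; first exact: le_trans (hm l) c1.
  by rewrite lerD2l ler_wpM2l// -real_normK ?num_real// lerXn2r ?nnegrE.
apply: (@le_trans _ _ (\sum_l p l
    * (expR m * (1 + (h (upd psi b l) - m) + 2 * c ^+ 2)))).
  by apply: ler_sum => l _; rewrite ler_wpM2l.
under eq_bigr do rewrite mulrCA.
rewrite -mulr_sumr [leRHS]mulrC ler_wpM2l ?expR_ge0//.
rewrite (eq_bigr (fun l => p l * (1 - m + 2 * c ^+ 2) + p l * h (upd psi b l))).
  rewrite big_split/= -mulr_suml p_sum1 -/(resample b h psi) -/m.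
  apply: le_trans (expR_ge1Dx _); lra.
by move=> l _; ring.
Qed.

(* Bounded differences inequality: replace the coordinates by their averages
   one at a time, each replacement costing a factor [expR (2 * c ^+ 2)]. *)
Lemma expect_expR_le c h : 0 <= c -> c <= 2^-1 -> bounded_diff c h ->
  expect (fun psi => expR (h psi))
  <= expR (expect h + 2 * c ^+ 2 * #|I|%:R).
Proof.
move=> c0 c1 hc.
pose A (s : seq I) := foldr (fun b h => resample b h) h s.
have Ac s : bounded_diff c (A s).
  by elim: s => //= b s ih; exact: bounded_diff_resample.
have EA s : expect (A s) = expect h.
  by elim: s => //= b s <-; rewrite expect_resample.
have expA s : expect (fun psi => expR (h psi))
    <= expR (2 * c ^+ 2) ^+ size s * expect (fun psi => expR (A s psi)).
  elim: s => [|b s ih]; first by rewrite mul1r.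
  apply: (le_trans ih); rewrite /= [_ ^+ (size s).+1]exprSr -mulrA.
  rewrite ler_wpM2l ?exprn_ge0 ?expR_ge0//.
  rewrite -expectZ -(expect_resample b); apply: le_expect => psi.
  exact: resample_expR.
have Aupd s b psi l : b \in s -> A s (upd psi b l) = A s psi.
  elim: s psi => //= b' s ih psi; rewrite inE.
  have [->|bb'/= bs] := eqVneq b b'; first by rewrite resample_upd.
  by apply: eq_bigr => l' _; rewrite upd_comm// ih.
(* All coordinates have been averaged out; [psi] is turned into [psi'] one coordinate at a time
   without changing the value. *)
have Acst psi psi' : A (enum I) psi = A (enum I) psi'.
  pose mix (s : seq I) := [ffun i => if i \in s then psi' i else psi i].
  have -> : psi' = mix (enum I) by apply/ffunP => i; rewrite ffunE mem_enum.
  have -> : A (enum I) psi = A (enum I) (mix [::]).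
    by congr A; apply/ffunP => i; rewrite ffunE.
  elim: {3}(enum I) => // b s ih.
  have -> : mix (b :: s) = upd (mix s) b (psi' b).
    by apply/ffunP => i; rewrite !ffunE inE; case: eqVneq => // ->.
  by rewrite Aupd ?mem_enum.
apply: (le_trans (expA (enum I))).
have -> : expect (fun psi => expR (A (enum I) psi)) = expR (expect h).
  (* The constant is evaluated at some labelling [psi0], which exists because the weights of all
     labellings sum to 1. *)
  have [/eqP|] := eqVneq #|{ffun I -> L}| 0%N.
    move/eqP/fintype0 => abs.
    have := expect_cst 1; rewrite /expect big1 => [/eqP|psi]; last by case: (abs psi).
    by rewrite eq_sym oner_eq0.
  rewrite -lt0n => /card_gt0P[psi0 _].
  rewrite -[RHS]expect_cst -(EA (enum I)); apply: eq_expect => psi.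
  congr expR; rewrite -[LHS](expect_cst (A (enum I) psi)); apply: eq_expect => ?.
  exact: Acst.
rewrite -expRM_natl -expRD -cardE ler_expR; lra.
Qed.

End ProductExpectation.

(** * Local statistics and codes *)

Section LocalStatistics.
Variables (R : realType) (L I J : finType) (p : L -> R).
Hypotheses (p_ge0 : forall l, 0 <= p l) (p_sum1 : \sum_l p l = 1).

(** Marginals of a product weight are product weights: [g] is expanded over patterns [q] into
    products of one-coordinate indicators, and injectivity of [tau] puts at most one constraint on
    each coordinate. *)
Lemma expect_local (tau : J -> I) (g : {ffun J -> L} -> R) : injective tau ->
  expect p (fun psi : {ffun I -> L} => g [ffun j => psi (tau j)]) = expect p g.
Proof.
move=> tau_inj.
transitivity (expect p (fun psi : {ffun I -> L} => \sum_(q : {ffun J -> L})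
    g q * \prod_i \prod_(j | tau j == i) (psi i == q j)%:R)).
  apply: eq_expect => psi.
  rewrite (bigD1 [ffun j => psi (tau j)])//= [X in _ + X]big1 => [|q qpsi].
    rewrite addr0 [X in _ * X]big1 ?mulr1// => i _.
    by rewrite big1// => j /eqP <-; rewrite ffunE eqxx.
  have /existsP[j jq] : [exists j, psi (tau j) != q j].
    apply: contraR qpsi => /existsPn qpsi; apply/eqP/ffunP => j.
    by rewrite ffunE; have /negPn/eqP := qpsi j.
  rewrite (bigD1 (tau j))//= (bigD1 j)//= (negbTE jq).
  by rewrite !mul0r mulr0.
rewrite expect_sum; apply: eq_bigr => q _; rewrite expectZ mulrC; congr (_ * _).
rewrite (expect_prod p (fun i l => \prod_(j | tau j == i) (l == q j)%:R)).
rewrite /pweight (partition_big tau predT)//=.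
apply: eq_bigr => i _.
case: (pickP (fun j => tau j == i)) => [j /eqP tj|no].
  have jE k : (tau k == i) = (k == j) by rewrite -tj (inj_eq tau_inj).
  under eq_bigr => l _ do rewrite (eq_bigl _ _ jE) big_pred1_eq.
  rewrite (eq_bigl _ _ jE) big_pred1_eq (bigD1 (q j))//= eqxx mulr1.
  by rewrite big1 ?addr0// => l /negbTE ->; rewrite mulr0.
under eq_bigr => l _ do rewrite big_pred0// mulr1.
by rewrite p_sum1 big_pred0.
Qed.

Variables (tau : I -> J -> I) (g : {ffun J -> L} -> R).
Hypotheses (tau_inj : forall j, injective (tau^~ j)) (g_le1 : forall q, `|g q| <= 1).

(** [tau a j] is the site at position [j] of the window seen from [a]. *)
Definition local_sum (psi : {ffun I -> L}) : R :=
  \sum_a g [ffun j => psi (tau a j)].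

Let g_diff q q' : `|g q - g q'| <= 2.
Proof.
by rewrite (le_trans (ler_normB _ _))// -[2]/(1 + 1) lerD.
Qed.

(** A change at [b] affects only windows containing [b]. For each [j] at most one site has [b] at
    position [j], and each affected term moves by at most 2. *)
Lemma bounded_diff_local_sum : bounded_diff (2 * #|J|%:R) local_sum.
Proof.
move=> psi b l; rewrite -sumrB; apply: le_trans (ler_norm_sum _ _ _) _.
apply: (@le_trans _ _ (\sum_a \sum_j 2 * (tau a j == b)%:R)).
  apply: ler_sum => a _.
  case: (pickP (fun j => tau a j == b)) => [j tj|no].
    rewrite (bigD1 j)//= tj mulr1 ler_wpDr//.
    by apply: sumr_ge0 => k _; rewrite mulr_ge0.
  rewrite [X in g X - _](_ : _ = [ffun j => psi (tau a j)]).
    by rewrite subrr normr0 sumr_ge0// => k _; rewrite mulr_ge0.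
  by apply/ffunP => j; rewrite !ffunE no.
rewrite exchange_big/= -sum1_card natr_sum mulr_sumr; apply: ler_sum => j _.
rewrite -mulr_sumr ler_wpM2l//.
case: (pickP (fun a => tau a j == b)) => [a /eqP ta|no]; last first.
  by rewrite big1// => a _; rewrite no.
rewrite (bigD1 a)//= big1 => [|c ca]; first by rewrite addr0 ler_nat leq_b1.
by rewrite -ta (inj_eq (@tau_inj j)) (negbTE ca).
Qed.

Definition num_noninjective : nat := #|[pred a | ~~ injectiveb (tau a)]|.

(** A site with injective window contributes exactly [expect p g]; at any other site two quantities
    of absolute value at most 1 are compared. *)
Lemma expect_local_sum :
  `|expect p local_sum - #|I|%:R * expect p g| <= 2 * num_noninjective%:R.
Proof.
have le1 (K : finType) (h : {ffun K -> L} -> R) :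
    (forall q, `|h q| <= 1) -> `|expect p h| <= 1.
  move=> h1; rewrite -(@expect_cst R L K p p_sum1 1) ler_norml; apply/andP; split.
    rewrite -mulN1r -expectZ; apply: le_expect => // q.
    by have := h1 q; rewrite ler_norml mulr1 => /andP[].
  by apply: le_expect => // q; have := h1 q; rewrite ler_norml => /andP[].
rewrite /local_sum expect_sum mulr_natl -sumr_const -sumrB.
apply: le_trans (ler_norm_sum _ _ _) _.
rewrite /num_noninjective -sum1_card natr_sum mulr_sumr [leRHS]big_mkcond/=.
apply: ler_sum => a _; case: ifPn => [_|]; last first.
  rewrite inE negbK => /injectiveP ta.
  by rewrite expect_local// subrr normr0.
by rewrite mulr1 (le_trans (ler_normB _ _))// -[2]/(1 + 1) lerD// le1.
Qed.

(** Bounded differences with [c = 2 |s| #|J|]: the assumption on [s] is [c <= 1/2], and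
    [2 c^2 = 8 (s #|J|)^2]. *)
Lemma expect_expR_local_sum (s : R) : `|s| * #|J|%:R <= 4^-1 ->
  expect p (fun psi => expR (s * local_sum psi))
  <= expR (s * (#|I|%:R * expect p g) + 2 * `|s| * num_noninjective%:R
           + 8 * (s * #|J|%:R) ^+ 2 * #|I|%:R).
Proof.
move=> sJ.
have sc0 : 0 <= `|s| * (2 * #|J|%:R) by rewrite !mulr_ge0.
apply: le_trans (expect_expR_le p_ge0 p_sum1 sc0 _ _) _; first by lra.
  move=> psi b l; rewrite -mulrBr normrM ler_wpM2l//.
  exact: bounded_diff_local_sum.
rewrite ler_expR expectZ lerD//; last first.
  by rewrite !exprMn real_normK ?num_real// le_eqVlt; apply/orP; left; apply/eqP; ring.
rewrite -lerBlDl -mulrBr (le_trans (ler_norm _))// normrM -mulrA mulrCA.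
by rewrite ler_wpM2l// expect_local_sum.
Qed.

End LocalStatistics.

(** * Weighted sums over codes with few errors *)

Section Codes.
Variables (R : realType) (L J : finType).

Definition num_errors (I : finType) (tau : I -> J -> I)
    (u : {ffun I -> L} * {ffun I * J -> L}) : nat :=
  #|[pred v : I * J | u.2 v != u.1 (tau v.1 v.2)]|.

(* Penalize each error by a factor [t := expR (- r)]: the sum over the second
   component then factors as a product of [1 + (#|L| - 1) * t]. *)
Lemma sum_codes (eta : R) : 0 < eta -> exists2 kappa : R, 0 < kappa <= eta &
  forall (I : finType) (tau : I -> J -> I) (w : {ffun I -> L} -> R),
    (forall psi, 0 <= w psi) ->
    \sum_(u | (num_errors tau u)%:R <= kappa * #|I|%:R) w u.1
    <= expR (eta * #|I|%:R) * \sum_psi w psi.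
Proof.
move=> eta0; pose N : R := #|L|%:R * #|J|%:R.
have N0 : 0 <= N by rewrite mulr_ge0.
(* As [exp(-r) <= 1 / (1 + r)], this [r] gives [exp(-r) * N <= eta / 2]: allowing penalized errors
   costs at most [eta / 2] per site. *)
pose r := 2 * N / eta.
have r0 : 0 <= r by rewrite !mulr_ge0 ?invr_ge0 // ltW.
have tN : expR (- r) * N <= eta / 2.
  apply: (@le_trans _ _ ((1 + r)^-1 * N)).
    by rewrite ler_wpM2r// expRN lef_pV2 ?posrE ?expR_gt0 ?expR_ge1Dx//; lra.
  rewrite mulrC ler_pdivrMr; last by lra.
  by rewrite -subr_ge0 (_ : _ - N = eta / 2) ?divr_ge0 ?ltW// /r; field; exact: lt0r_neq0.
(* This [kappa] satisfies [r * kappa <= eta / 2], so undoing the penalty on codes with few errors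
   costs the other [eta / 2] per site. *)
exists (eta / (2 * (r + 1))).
  rewrite divr_gt0 ?mulr_gt0//; last by lra.
  by rewrite ler_pdivrMr ?mulr_gt0// ?ler_peMr ?(ltW eta0)//; lra.
move=> I tau w w0; set kappa := eta / _.
pose t (u : {ffun I -> L} * {ffun I * J -> L}) (v : I * J) : R :=
  if u.2 v == u.1 (tau v.1 v.2) then 1 else expR (- r).
have tE u : \prod_v t u v = expR (- (r * (num_errors tau u)%:R)).
  rewrite -mulNr mulrC expRM_natl /num_errors -sum1_card.
  rewrite (big_morph _ (exprD _) (expr0 _)).
  rewrite [RHS]big_mkcond/=.
  by apply: eq_bigr => v _; rewrite /t inE; case: eqP.
have sumt psi : \sum_P \prod_v t (psi, P) v <= expR (eta / 2 * #|I|%:R).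
  rewrite -(bigA_distr_bigA (fun v l => if l == psi (tau v.1 v.2) then 1
    else expR (- r))).
  apply: (@le_trans _ _ (\prod_(v : I * J) expR (#|L|%:R * expR (- r)))).
    apply: ler_prod => v _; rewrite sumr_ge0/= => [|l _]; last first.
      by case: ifP => // _; exact: expR_ge0.
    rewrite (le_trans _ (expR_ge1Dx _))// (bigD1 (psi (tau v.1 v.2)))//= eqxx.
    rewrite lerD2l mulr_natl -sumr_const [leRHS](bigD1 (psi (tau v.1 v.2)))//=.
    rewrite ler_wpDl ?expR_ge0// ler_sum// => l /negbTE ->.
    exact: lexx.
  rewrite prodr_const card_prod -expRM_natl ler_expR natrM.
  by rewrite [X in X <= _](_ : _ = expR (- r) * N * #|I|%:R) ?ler_wpM2r// /N; ring.
apply: (@le_trans _ _ (\sum_(u | (num_errors tau u)%:R <= kappa * #|I|%:R)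
    expR (r * (kappa * #|I|%:R)) * (w u.1 * \prod_v t u v))).
  apply: ler_sum => u eu; rewrite mulrCA ler_peMr// tE -expRD.
  by rewrite -[leLHS]expR0 ler_expR subr_ge0 ler_wpM2l.
apply: (@le_trans _ _ (\sum_u
    expR (r * (kappa * #|I|%:R)) * (w u.1 * \prod_v t u v))).
  rewrite [leRHS](bigID (fun u => (num_errors tau u)%:R <= kappa * #|I|%:R))/= lerDl.
  by apply: sumr_ge0 => u _; rewrite !mulr_ge0 ?expR_ge0// tE expR_ge0.
rewrite -mulr_sumr.
rewrite -(pair_bigA _ (fun psi P => w psi * \prod_v t (psi, P) v))/=.
apply: (@le_trans _ _ (expR (r * (kappa * #|I|%:R)) *
    \sum_psi w psi * expR (eta / 2 * #|I|%:R))).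
  rewrite ler_wpM2l ?expR_ge0// ler_sum// => psi _.
  by rewrite -mulr_sumr ler_wpM2l.
rewrite -mulr_suml mulrCA mulrC ler_wpM2r ?sumr_ge0// -expRD ler_expR.
rewrite mulrA -mulrDl ler_wpM2r//.
have rk : r * kappa <= eta / 2.
  rewrite /kappa mulrA ler_pdivrMr; last by lra.
  by rewrite [leRHS](_ : _ = eta * (r + 1)); [nra|field].
lra.
Qed.

End Codes.

(** * Topology of the shift space *)

Section ShiftSpace.
Variables (G : groupType) (L : finPointedType).
Local Notation X := (shift_space G L).

Definition agree (W : {fset G}) (x y : X) : Prop := forall g, g \in W -> x g = y g.

Lemma coord_continuous (g : G) :
  continuous ((fun x => x g) : X -> discrete_topology L).
Proof. exact: (@proj_continuous _ (fun=> discrete_topology L) g). Qed.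

(** For the forward direction, the sets containing some window class of [x] form a filter that
    converges to [x] in every coordinate, hence in the product topology. *)
Lemma shift_nbhsP (x : X) (A : set X) :
  nbhs x A <-> exists W, [set y | agree W x y] `<=` A.
Proof.
split=> [xA|[W WA]]; last first.
  apply: filterS WA _.
  suff : nbhs x (\bigcap_(g in [set` W]) [set y : X | x g = y g]).
    by apply: filterS => y + g gW; apply.
  apply: filter_bigI => g gW.
  have -> : [set y : X | x g = y g]
      = (fun y : X => y g : discrete_topology L) @^-1` [set x g].
    by apply/seteqP; split => y.
  exact/coord_continuous/discrete_set1.
pose F : set_system X := [set B | exists W, [set y | agree W x y] `<=` B].
have FF : Filter F.
  split.
  - by exists fset0.
  - move=> P Q [W WP] [W' WQ]; exists (W `|` W')%fset => y yW; split.
      by apply: WP => g gW; apply: yW; rewrite in_fsetU gW.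
    by apply: WQ => g gW; apply: yW; rewrite in_fsetU gW orbT.
  - by move=> P Q PQ [W WP]; exists W; apply: subset_trans PQ.
suff : F --> x by move=> /(_ A xA).
apply/cvg_sup => g U [V [[W _ <-] Wx WU]].
by exists [fset g]%fset => y yg; apply: WU; rewrite /= -yg// inE.
Qed.

Lemma shift_compact : compact [set: X].
Proof.
have := @tychonoff G  (fun=> discrete_topology L) (fun=> setT).
have -> : [set f : G -> discrete_topology L |
    forall i, [set: discrete_topology L] (f i)] = setT.
  by apply/seteqP; split.
by apply=> g; apply: finite_compact; exact: finite_finset.
Qed.

Lemma agree_refl W x : agree W x x.
Proof. by []. Qed.

Lemma agree_sub W W' x y : {subset W <= W'} -> agree W' x y -> agree W x y.
Proof. by move=> WW' xy g /WW'; exact: xy. Qed.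

Lemma open_agree W x : open [set y | agree W x y].
Proof.
rewrite openE => y xy; apply/shift_nbhsP; exists W => z yz g gW.
by rewrite xy// yz.
Qed.

(** A Lebesgue number lemma with windows in place of radii: compactness leaves finitely many
    centres, and the union of their windows works for every point. *)
Lemma finite_window_cover (V : X -> set X) : (forall x, nbhs x (V x)) ->
  exists W : {fset G}, exists D : {fset X},
    forall y, exists2 x, x \in D & forall z, agree W y z -> V x z.
Proof.
move=> Vx.
have /choice[Wx WxV] : forall x, exists W, [set y | agree W x y] `<=` V x.
  by move=> x; exact/shift_nbhsP.
have := shift_compact; rewrite compact_cover.
move=> /(_ X setT (fun x => [set y | agree (Wx x) x y])) [].
- by move=> x _; exact: open_agree.
- by move=> x _; exists x.
move=> D _ Dcov; exists (\bigcup_(x <- D) Wx x)%fset, D => y.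
have [x /= xD xy] := Dcov y I; exists x => // z yz; apply: WxV => g gW.
by rewrite xy// yz//; apply/bigfcupP; exists x => //; rewrite andbT.
Qed.

Definition pat (W : {fset G}) (x : X) : {ffun W -> L} := [ffun j => x (val j)].

(** A representative of the cylinder of [q], labelled by the base point outside [W]; it is a section
    of [pat W]. *)
Definition ext (W : {fset G}) (q : {ffun W -> L}) : X :=
  fun g => if insub g is Some j then q j else point.

Lemma agree_pat W x y : agree W x y <-> pat W x = pat W y.
Proof.
split=> [xy|/ffunP xy g gW]; first by apply/ffunP => j; rewrite !ffunE xy ?fsvalP.
by have := xy [` gW]%fset; rewrite !ffunE.
Qed.

Lemma extK W : cancel (@ext W) (pat W).
Proof.
move=> q; apply/ffunP => j; rewrite ffunE /ext insubT ?fsvalP// => p.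
by congr (q _); apply: val_inj.
Qed.

Lemma agree_ext W x : agree W x (ext (pat W x)).
Proof. by apply/agree_pat; rewrite extK. Qed.

Lemma uniform_window (R : realType) (u : X -> R) : continuous u ->
  forall e : R, 0 < e -> exists W, forall y z, agree W y z -> `|u y - u z| < e.
Proof.
move=> u_cont e e0; have e20 : 0 < e / 2 by rewrite divr_gt0.
have [|W [D WD]] := @finite_window_cover (fun x => [set y | `|u x - u y| < e / 2]).
  move=> x; have /cvgrPdist_lt/(_ _ e20) := u_cont x; exact.
exists W => y z yz; have [x _ xW] := WD y.
have /= := xW y (@agree_refl _ _); have /= := xW z yz.
by rewrite !ltr_norml => /andP[? ?] /andP[? ?]; apply/andP; split; lra.
Qed.

Lemma continuous_pat (R : realType) (W : {fset G}) (g : {ffun W -> L} -> R) :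
  continuous (fun x => g (pat W x)).
Proof.
move=> x A /nbhs_singleton gx; apply/shift_nbhsP; exists W => y /agree_pat xy /=.
by rewrite -xy.
Qed.

(** * Comparison of a compatible metric with finite windows *)

Section Metric.
Variables (R : realType) (rho : X -> X -> R).
Hypothesis rhoP : compatible_metric rho.

Lemma metric_window e : 0 < e ->
  exists W, forall y z, agree W y z -> rho y z < e.
Proof.
move=> e0; have [rho0 rhoxx rhoC rhoT rhoN] := rhoP.
have e20 : 0 < e / 2 by rewrite divr_gt0.
have [|W [D WD]] := @finite_window_cover (fun x => [set y | rho x y < e / 2]).
  by move=> x; apply/rhoN; exists (e / 2).
exists W => y z yz; have [x _ xW] := WD y.
have /= := xW y (@agree_refl _ _); have /= := xW z yz.
have := rhoT y x z; rewrite (rhoC y x); lra.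
Qed.

(** Around each [x] some ball has constant label at [g]. Finitely many balls of half the radius
    cover the space, and the smallest half radius is uniform. *)
Lemma metric_separates g :
  exists2 e, 0 < e & forall y z, rho y z < e -> y g = z g.
Proof.
have [rho0 rhoxx rhoC rhoT rhoN] := rhoP.
have /choice[ex exP] : forall x, exists e, 0 < e /\ forall y, rho x y < e -> x g = y g.
  move=> x; have : nbhs x [set y | agree [fset g]%fset x y].
    by apply/shift_nbhsP; exists [fset g]%fset.
  move=> /rhoN[e e0 eP]; exists e; split=> // y /eP; apply.
  by rewrite inE.
have [|W [D WD]] := @finite_window_cover (fun x => [set y | rho x y < ex x / 2]).
  move=> x; apply/rhoN; exists (ex x / 2) => //.
  by rewrite divr_gt0//; case: (exP x).
exists (\big[Num.min/1]_(x : D) (ex (val x) / 2)).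
  elim/big_ind : _ => // [a b a0 b0|x _]; first by rewrite lt_min a0.
  by rewrite divr_gt0//; case: (exP (val x)).
move=> y z yz; have [x xD xW] := WD y.
have /= xy := xW y (@agree_refl _ _).
have xe : rho y z < ex x / 2 by apply: lt_le_trans yz _;
  exact: (@bigmin_le _ _ _ _ [` xD]%fset).
have [ex0 exx] := exP x.
rewrite -(exx y); last by lra.
by apply: exx; have := rhoT x y z; lra.
Qed.

(** Finitely many unit balls cover the space, so a distance is at most 2 plus a distance between
    centres; the double sum dominates all of the latter. *)
Lemma metric_bounded : exists2 B, 0 < B & forall y z, rho y z <= B.
Proof.
have [rho0 rhoxx rhoC rhoT rhoN] := rhoP.
have [|W [D WD]] := @finite_window_cover (fun x => [set y | rho x y < 1]).
  by move=> x; apply/rhoN; exists 1.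
exists (2 + \sum_(x <- D) \sum_(x' <- D) rho x x').
  by rewrite ltr_wpDr//; apply: sumr_ge0 => x _; apply: sumr_ge0.
move=> y z; have [x xD xW] := WD y; have [x' xD' xW'] := WD z.
have /= xy := xW y (@agree_refl _ _); have /= xz := xW' z (@agree_refl _ _).
have : rho x x' <= \sum_(x <- D) \sum_(x' <- D) rho x x'.
  rewrite (big_fsetD1 x)//= ler_wpDr//.
    by apply: sumr_ge0 => ? _; apply: sumr_ge0.
  by rewrite (big_fsetD1 x')//= ler_wpDr//; apply: sumr_ge0.
have := rhoT y x z; have := rhoT x x' z; rewrite (rhoC y x); lra.
Qed.

End Metric.

End ShiftSpace.

(** * Borel sets and cylinders *)

Section FiniteValued.
Context d (T : measurableType d) (R : realType) (mu : probability T R).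

Lemma integral_finite_valued (Q : finType) (h : T -> Q) (g : Q -> R) :
  (forall q, measurable (h @^-1` [set q])) ->
  (\int[mu]_x (g (h x))%:E = \sum_q (g q)%:E * mu (h @^-1` [set q]))%E.
Proof.
move=> mh.
have intq q : mu.-integrable setT (fun x => ((g q)%:E * (\1_(h @^-1` [set q]) x)%:E)%E).
  by apply: integrableZl => //; exact: integrable_indic.
transitivity (\int[mu]_x (\sum_q (g q)%:E * (\1_(h @^-1` [set q]) x)%:E))%E.
  apply: eq_integral => x _; rewrite (bigD1 (h x))//= big1 => [|q qx].
    by rewrite adde0 indicE mem_set//= mule1.
  rewrite indicE memNset ?mule0// => hx.
  by move: qx; rewrite -[q]hx eqxx.
rewrite integral_sum//; apply: eq_bigr => q _.
by rewrite integralZl ?integrable_indic// integral_indic// setIT.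
Qed.

Lemma measure_finite_valued (Q : finType) (h : T -> Q) (A : {pred Q}) :
  (forall q, measurable (h @^-1` [set q])) ->
  (mu (h @^-1` [set` A]) = \sum_(q in A) mu (h @^-1` [set q]))%E.
Proof.
move=> mh.
have mA : measurable (h @^-1` [set` A]).
  rewrite (_ : _ @^-1` _ = \bigcup_(q in [set` A]) (h @^-1` [set q])).
    by apply: fin_bigcup_measurable => //; exact: finite_finset.
  by apply/seteqP; split=> [x /= xA|x [q /= qA hx]]; [exists (h x)|rewrite hx].
rewrite -[h @^-1` [set` A]]setIT -integral_indic//.
rewrite (eq_integral (fun x => (h x \in A)%:R%:E)); last first.
  by move=> x _; rewrite indicE/= (_ : (x \in _) = (h x \in A))//; apply/idP/idP;
    [move/set_mem|move=> hx; apply/mem_set].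
rewrite (integral_finite_valued (fun q => (q \in A)%:R))//.
rewrite [RHS]big_mkcond; apply: eq_bigr => q _.
by case: ifP; rewrite ?mul1e ?mul0e.
Qed.

End FiniteValued.

Section BorelShift.
Variables (G : groupType) (L : finPointedType).
Hypothesis G_countable : countable [set: G].
Local Notation X := (shift_space G L).

Definition cyl (F : {fset G}) (A : G -> set L) : set X :=
  [set x : X | forall g, g \in F -> A g (x g)].

Definition cylinders : set (set X) := [set cyl F A | F in setT & A in setT].

Lemma cyl_pat (W : {fset G}) (q : {ffun W -> L}) :
  [set x | pat W x = q] = cyl W (fun g => [set ext q g]).
Proof.
apply/seteqP; split=> x; rewrite /cyl/=.
  by move=> <- g gW; rewrite -(agree_ext x gW).
by move=> xq; rewrite -(extK q); apply/agree_pat => g gW; exact: xq.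
Qed.

(** [W n] is the image of the numbers below [n] under a left inverse [e] of an injective numbering
    of [G]; this is where countability enters. *)
Lemma exhausting_windows : exists W : nat -> {fset G},
  forall F : {fset G}, exists n, {subset F <= W n}.
Proof.
have [i i_inj] := countable_injP _ G_countable.
have /choice[e eP] : forall n, exists g, (exists g', i g' = n) -> i g = n.
  move=> n; have [[g gn]|no] := pselect (exists g, i g = n); first by exists g.
  by exists 1%g.
have ei g : e (i g) = g by apply: i_inj; rewrite ?inE//; apply: eP; exists g.
exists (fun n => [fset e k | k in iota 0 n]%fset) => F.
exists (\max_(g <- F) i g)%N.+1 => g gF; apply/imfsetP.
exists (i g); last by rewrite ei.
change (i g \in iota 0 (\max_(g <- F) i g)%N.+1).
rewrite mem_iota leq0n add0n ltnS andTb.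
exact: (@leq_bigmax_seq G (enum_fset F) xpredT i g gF isT).
Qed.

(** An open set is the countable union, over [n], of the finitely many cylinders of [W n]-patterns
    contained in it. *)
Lemma open_sub_cylinders (U : set X) : open U -> <<s cylinders >> U.
Proof.
move=> oU; have [W WP] := exhausting_windows.
have -> : U = \bigcup_n \bigcup_(q in [set q : {ffun W n -> L} |
    [set x | pat (W n) x = q] `<=` U]) [set x | pat (W n) x = q].
  apply/seteqP; split=> [x Ux|x [n _ [q qU /qU//]]].
  move: oU; rewrite openE => /(_ x Ux)/shift_nbhsP[F FU].
  have [n Fn] := WP F; exists n => //; exists (pat (W n) x) => //= y yx.
  by apply: FU; apply: (agree_sub Fn); exact/agree_pat.
apply: sigma_algebra_bigcup => n.
apply: (@fin_bigcup_measurable _ (g_sigma_algebraType cylinders)).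
  exact: finite_finset.
by move=> q _; apply: sub_sigma_algebra; rewrite cyl_pat;
  exists (W n) => //; exists (fun g => [set ext q g]).
Qed.

Lemma open_cyl F A : open (cyl F A).
Proof.
rewrite openE => x xA; apply/shift_nbhsP; exists F => y xy g gF.
by rewrite -xy//; exact: xA.
Qed.

Lemma measurable_cyl F A : measurable (cyl F A : set (borel X)).
Proof. by apply: sub_sigma_algebra; exact: open_cyl. Qed.

Lemma borel_cylinders : @measurable _ (borel X) = <<s cylinders >>.
Proof.
apply/seteqP; split; apply: smallest_sub.
- exact: smallest_sigma_algebra.
- exact: open_sub_cylinders.
- exact: smallest_sigma_algebra.
- by move=> _ [F _ [A _ <-]]; apply: sub_sigma_algebra; exact: open_cyl.
Qed.

(** Cylinders are stable under intersection and generate the Borel sets, so the uniqueness theorem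
    for finite measures applies. *)
Lemma measure_cylinders_unique (R : realType)
    (mu nu : probability (borel X) R) :
  (forall F A, mu (cyl F A) = nu (cyl F A)) ->
  forall A : set (borel X), measurable A -> mu A = nu A.
Proof.
move=> munu B mB; apply: (@measure_unique _ R (borel X) cylinders (fun=> setT)) => //.
- exact: borel_cylinders.
- move=> _ _ [F _ [A _ <-]] [F' _ [A' _ <-]].
  exists (F `|` F')%fset => //.
  exists (fun g l => (g \in F -> A g l) /\ (g \in F' -> A' g l)) => //.
  apply/seteqP; split=> x /=.
    by move=> xA; split=> g gF; have := xA g; rewrite in_fsetU gF ?orbT => /(_ isT)[]; auto.
  by move=> [xA xA'] g _; split; [exact: xA|exact: xA'].
- move=> _; exists fset0 => //; exists (fun _ _ => True) => //.
  by apply/seteqP; split.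
- by rewrite bigcup_const//; exists 0%N.
- by move=> _ [F _ [A _ <-]]; exact: munu.
- by move=> _; rewrite (le_lt_trans (probability_le1 mu measurableT))// ltry.
Qed.

Lemma measurable_into_shift d (T : measurableType d) (h : T -> X) :
  (forall F A, measurable (h @^-1` cyl F A)) ->
  measurable_fun setT (h : T -> borel X).
Proof.
move=> hm; apply: (@measurability _ _ T (borel X) setT h cylinders).
  exact: borel_cylinders.
by move=> _ [_ [F _ [A _ <-]] <-]; rewrite setTI; exact: hm.
Qed.

Lemma measurable_pat (W : {fset G}) (q : {ffun W -> L}) :
  measurable ((pat W : borel X -> _) @^-1` [set q]).
Proof. by rewrite [X in measurable X]cyl_pat; exact: measurable_cyl. Qed.

Section Integrals.
Variables (R : realType) (mu : probability (borel X) R).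

Lemma continuous_measurable (u : X -> R) : continuous u ->
  measurable_fun setT (u : borel X -> R).
Proof.
move=> u_cont; apply: (measurability _ (measurable_realfun.RGenOpens.measurableE R)).
move=> _ [_ [x [y ->]] <-]; rewrite setTI; apply: sub_sigma_algebra.
by apply: open_comp; [move=> z _; exact: u_cont|exact: interval_open].
Qed.

Lemma continuous_bounded (u : X -> R) : continuous u ->
  exists M, forall x, `|u x| <= M.
Proof.
move=> u_cont; have [W WP] := uniform_window u_cont ltr01.
exists (1 + \sum_(q : {ffun W -> L}) `|u (ext q)|) => x.
rewrite -(subrK (u (ext (pat W x))) (u x)) (le_trans (ler_normD _ _))// lerD//.
  by rewrite ltW// WP//; exact: agree_ext.
by rewrite (bigD1 (pat W x))//= lerDl sumr_ge0.
Qed.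

Lemma continuous_integrable (u : X -> R) : continuous u ->
  mu.-integrable setT (EFin \o u).
Proof.
move=> u_cont; apply: measurable_bounded_integrable => //.
- by rewrite (le_lt_trans (probability_le1 mu measurableT))// ltry.
- exact: continuous_measurable.
- have [M uM] := continuous_bounded u_cont.
  exists M; split; first exact: num_real.
  by move=> y My x _ /=; rewrite (le_trans (uM x))// ltW.
Qed.

Lemma Rintegral_pat (W : {fset G}) (g : {ffun W -> L} -> R) :
  (\int[mu]_x g (pat W x) = \sum_q g q * fine (mu (cyl W (fun w => [set ext q w]))))%R.
Proof.
rewrite /Rintegral (integral_finite_valued mu g (@measurable_pat W)).
rewrite -sum_fine => [|q _]; last first.
  by rewrite fin_numM// fin_num_measure//; exact: measurable_pat.
apply: eq_bigr => q _; rewrite fineM// ?fin_num_measure//; last exact: measurable_pat.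
by rewrite [X in mu X]cyl_pat.
Qed.

Lemma Rintegral_close (u v : X -> R) e : continuous u -> continuous v ->
  (forall x, `|u x - v x| <= e) -> `|\int[mu]_x u x - \int[mu]_x v x| <= e.
Proof.
move=> cu cv uv.
have iu := continuous_integrable cu; have iv := continuous_integrable cv.
have iuv : mu.-integrable setT (EFin \o (fun x => u x - v x)).
  exact: (integrableB measurableT iu iv).
have ic (c : R) : mu.-integrable setT (EFin \o (fun=> c)).
  exact: finite_measure_integrable_cst.
have intc c : \int[mu]_x c = c :> R.
  rewrite Rintegral_cst// -[RHS]mulr1; congr (_ * _).
  exact: (congr1 fine (probability_setT mu)).
rewrite -RintegralB// ler_norml; apply/andP; split.
  rewrite -[leLHS]intc; apply: le_Rintegral => //.
  by move=> x _; have := uv x; rewrite ler_norml => /andP[].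
rewrite -[leRHS]intc; apply: le_Rintegral => //.
by move=> x _; have := uv x; rewrite ler_norml => /andP[].
Qed.

End Integrals.

End BorelShift.

(** * The product measure *)

Section UnitInterval.
Variable R : realType.

Definition unit_lebesgue : set (measurableTypeR R) -> \bar R :=
  mrestr (@lebesgue_measure R) (measurable_itv `[0, 1[).

HB.instance Definition _ := Measure.copy unit_lebesgue
  (mrestr (@lebesgue_measure R) (measurable_itv `[0, 1[)).

Let unit_lebesgue_setT : unit_lebesgue setT = 1%E.
Proof.
by rewrite /unit_lebesgue /mrestr setTI lebesgue_measure_itv/= lte01 oppr0 adde0.
Qed.

HB.instance Definition _ :=
  @Measure_isProbability.Build _ _ R unit_lebesgue unit_lebesgue_setT.

End UnitInterval.

(** * Arithmetic coding of the unit interval *)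

Section Digits.
Variables (R : realType) (L : finType) (p : L -> R).
Hypotheses (p_gt0 : forall l, 0 < p l) (p_sum1 : \sum_l p l = 1).

(** [a l] is the total weight of the letters enumerated before [l], so the intervals
    [[a l, a l + p l)] tile [[0, 1)]. *)
Lemma unit_partition : exists a : L -> R,
  [/\ forall l, 0 <= a l, forall l, a l + p l <= 1,
      forall x, 0 <= x < 1 -> exists l, a l <= x < a l + p l
    & forall x l l', a l <= x < a l + p l -> a l' <= x < a l' + p l' -> l = l'].
Proof.
pose b (k : nat) : R := \sum_(l | (enum_rank l < k)%N) p l.
have bS l : b (enum_rank l).+1 = b (enum_rank l) + p l.
  rewrite /b (bigD1 l)//= addrC; congr (_ + _); apply: eq_bigl => l'.
  by rewrite ltnS [in RHS]ltn_neqAle andbC (inj_eq val_inj) (inj_eq enum_rank_inj).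
have b_mono k k' : (k <= k')%N -> b k <= b k'.
  move=> kk'; rewrite /b [leRHS](bigID (fun l => (enum_rank l < k)%N))/=.
  rewrite ler_wpDr ?sumr_ge0// => [l _|]; first exact: ltW.
  rewrite le_eqVlt; apply/orP; left; apply/eqP; apply: eq_bigl => l.
  by case: (ltnP (enum_rank l) k) => [/leq_trans ->|]; rewrite ?andbF.
have bL : b #|L| = 1.
  by rewrite -p_sum1; apply: eq_bigl => l; rewrite ltn_ord.
have b0 : b 0%N = 0 by rewrite /b big_pred0.
exists (fun l => b (enum_rank l)); split.
- by move=> l; rewrite -b0 b_mono.
- by move=> l; rewrite -bS -bL b_mono.
- move=> x /andP[x0 x1].
  have exk : exists k, x < b k by exists #|L|; rewrite bL.
  case: (ex_minnP exk) => -[|k] xk kmin; first by move: xk; rewrite b0 ltNge x0.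
  have kL : (k < #|L|)%N by apply: kmin; rewrite bL.
  exists (enum_val (Ordinal kL)); rewrite -bS enum_valK/= xk andbT leNgt.
  by apply/negP => /kmin; rewrite ltnn.
- move=> x l l'; rewrite -!bS => /andP[xl lx] /andP[xl' l'x].
  apply: enum_rank_inj; apply: val_inj; apply/eqP; rewrite eqn_leq.
  apply/andP; split; rewrite leqNgt; apply/negP => /b_mono.
    by apply/negP; rewrite -ltNge; exact: le_lt_trans xl l'x.
  by apply/negP; rewrite -ltNge; exact: le_lt_trans xl' lx.
Qed.

(* Arithmetic coding: [[0, 1)] is cut into intervals of lengths [p l], each of
   them is cut in the same proportions, and so on; the digits of [x] record the
   intervals containing it. *)
Lemma digit_expansion (l0 : L) : exists digit : nat -> R -> L,
  forall w : seq L, exists c, [/\ 0 <= c, c + \prod_(l <- w) p l <= 1 &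
    forall x, 0 <= x < 1 ->
      (forall i, (i < size w)%N -> digit i x = nth l0 w i) <->
      c <= x < c + \prod_(l <- w) p l].
Proof.
have [a [a0 ap aex auniq]] := unit_partition.
have /choice[D DP] : forall x, exists l, 0 <= x < 1 -> a l <= x < a l + p l.
  move=> x; have [x01|] := boolP (0 <= x < 1); last by exists l0.
  by have [l] := aex x x01; exists l.
(* The affine map from the interval of [x] onto [[0, 1)]; iterating it shifts the digits. *)
pose T x := (x - a (D x)) / p (D x).
have TP x : 0 <= x < 1 -> 0 <= T x < 1.
  move=> /DP/andP[ax xa]; rewrite divr_ge0 ?subr_ge0//= ?ltr_pdivrMr//.
    by rewrite mul1r ltrBlDl.
  exact: ltW.
exists (fun i x => D (iter i T x)).
elim=> [|l w [c [c0 c1 cP]]].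
  by exists 0; rewrite big_nil add0r; split => // x x01; split.
exists (a l + p l * c); rewrite big_cons -addrA -mulrDr; split.
- by rewrite addr_ge0// mulr_ge0// ltW.
- by rewrite (le_trans _ (ap l))// lerD2l ler_piMr// ltW.
move=> x x01; have xT := cP (T x) (TP x x01).
have E : D x = l -> (a l + p l * c <= x < a l + p l * (c + \prod_(j <- w) p j))
    = (c <= T x < c + \prod_(j <- w) p j).
  move=> Dx; rewrite /T Dx ler_pdivlMr// ltr_pdivrMr//.
  by rewrite lerBrDl ltrBlDl ![_ * p l]mulrC.
split=> [xw|xw].
  have Dx : D x = l := xw 0%N isT.
  by rewrite E//; apply/xT => i iw; rewrite -iterSr; exact: (xw i.+1).
have Dx : D x = l.
  apply: (auniq x); first exact: DP.
  move: xw => /andP[cx xc]; apply/andP; split.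
    by rewrite (le_trans _ cx)// lerDl mulr_ge0// ltW.
  by rewrite (lt_le_trans xc)// lerD2l ler_piMr// ltW.
move: xw; rewrite E// => /xT xw [|i] // iw.
by rewrite /= -xw// -iterSr.
Qed.

End Digits.

Section ProductMeasure.
Variables (R : realType) (G : groupType) (L : finPointedType) (p : L -> R).
Hypotheses (p_gt0 : forall l, 0 < p l) (p_sum1 : \sum_l p l = 1).
Hypothesis G_countable : countable [set: G].
Local Notation X := (shift_space G L).

Lemma product_measure_exists : exists nu : probability (borel X) R,
  forall F A, nu (cyl F A) = (\prod_(g <- F) \sum_l p l * (l \in A g)%:R)%:E.
Proof.
have [idx idx_inj] := countable_injP _ G_countable.
have [digit digitP] := digit_expansion p_gt0 p_sum1 (point : L).
(* The digits are controlled only on [[0, 1)]; every other point is given the digits of 0, so that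
   [X_] is measurable on the whole line. *)
pose clip (x : R) : R := if 0 <= x < 1 then x else 0.
pose X_ (x : measurableTypeR R) : X := fun g => digit (idx g) (clip x).
pose h n (x : measurableTypeR R) : {ffun 'I_n -> L} := [ffun i : 'I_n => digit i (clip x)].
have hP n (q : {ffun 'I_n -> L}) : exists c, [/\ 0 <= c, c + pweight p q <= 1 &
    forall x, h n x = q <-> c <= clip x < c + pweight p q].
  have wE : \prod_(l <- [seq q i | i <- enum 'I_n]) p l = pweight p q.
    by rewrite big_map big_enum.
  have [c] := digitP [seq q i | i <- enum 'I_n].
  rewrite wE => -[c0 c1 cP]; exists c; split=> // x.
  have x01 : 0 <= clip x < 1 by rewrite /clip; case: ifP => // _; rewrite lexx ltr01.
  have nthE (i : 'I_n) : nth point [seq q i | i <- enum 'I_n] i = q i.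
    by rewrite (nth_map i) ?size_enum_ord// nth_ord_enum.
  split=> [hx|/(cP _ x01) xq].
    apply/(cP _ x01) => i; rewrite size_map size_enum_ord => iN.
    by rewrite (nthE (Ordinal iN)) -hx ffunE.
  apply/ffunP => i; rewrite ffunE xq ?nthE//.
  by rewrite size_map size_enum_ord.
have mh n q : measurable (h n @^-1` [set q]).
  have [c [c0 c1 cP]] := hP n q.
  (* Because of [clip], the complement of [[0, 1)] belongs to the preimage exactly when 0 lies in
     the coding interval of [q]. *)
  have -> : h n @^-1` [set q] = (`[0, 1[ `&` `[c, c + pweight p q[) `|`
      (if c <= 0 < c + pweight p q then ~` `[0, 1[ else set0).
    apply/seteqP; split=> x /=.
      move/cP; rewrite /clip; case: ifPn => x01 xc; first by left; rewrite !in_itv.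
      by right; rewrite xc /= in_itv/=; exact/negP.
    move=> [[x01 xc]|]; first by apply/cP; rewrite /clip -[0 <= x < 1]/(x \in `[0, 1[) x01.
    case: ifPn => // c00 /= /negP; rewrite in_itv/= => /negbTE x01.
    by apply/cP; rewrite /clip x01.
  apply: measurableU; first by apply: measurableI; exact: measurable_itv.
  by case: ifP => // _; apply: measurableC; exact: measurable_itv.
have hq n q : unit_lebesgue (h n @^-1` [set q]) = (pweight p q)%:E.
  have [c [c0 c1 cP]] := hP n q.
  have p0 : 0 <= pweight p q by apply: pweight_ge0 => l; exact: ltW.
  rewrite /unit_lebesgue /mrestr.
  have -> : h n @^-1` [set q] `&` `[0, 1[ = `[c, c + pweight p q[%classic.
    apply/seteqP; split=> x /=; rewrite !in_itv/=.
      by move=> [/cP + x01]; rewrite /clip x01.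
    move=> xc; have x01 : 0 <= x < 1 by move: xc => /andP[? ?]; apply/andP; split; lra.
    by split=> //; apply/cP; rewrite /clip x01.
  rewrite lebesgue_measure_itv/= lte_fin ltrDl; case: ltP => [_|p1].
    by rewrite -EFinD addrAC subrr add0r.
  by have /eqP -> : pweight p q == 0 by rewrite eq_le p1.
have mX F A : measurable (X_ @^-1` cyl F A) /\
  unit_lebesgue (X_ @^-1` cyl F A) = (\prod_(g <- F) \sum_l p l * (l \in A g)%:R)%:E.
  (* The first [N + 1] digits determine all labels on [F]; the probability of the cylinder is then a
     marginal of a product weight. *)
  pose N := (\max_(g : F) idx (val g))%N.
  have idxN (j : F) : (idx (val j) < N.+1)%N by rewrite ltnS; exact: (leq_bigmax j).
  pose tau (j : F) : 'I_N.+1 := Ordinal (idxN j).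
  pose A' : {pred {ffun 'I_N.+1 -> L}} :=
    [pred q : {ffun 'I_N.+1 -> L} | [forall j : F, q (tau j) \in A (val j)]].
  have XA : X_ @^-1` cyl F A = h N.+1 @^-1` [set` A'].
    apply/seteqP; split=> x.
      move=> xA; apply/forallP => j; rewrite ffunE inE; apply: xA; exact: fsvalP.
    move=> /forallP xA g gF; have := xA [` gF]%fset.
    by rewrite ffunE inE.
  split.
    rewrite XA (_ : _ @^-1` _ = \bigcup_(q in [set` A']) (h N.+1 @^-1` [set q])).
      by apply: fin_bigcup_measurable => //; exact: finite_finset.
    by apply/seteqP; split=> [x xA|x [q /= qA hx]]; [exists (h N.+1 x)|rewrite /= hx].
  rewrite XA (measure_finite_valued (@unit_lebesgue R : probability _ _) A' (mh _)).
  rewrite (eq_bigr (fun q => (pweight p q)%:E)); last by move=> q _; exact: hq.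
  rewrite sumEFin big_mkcond/=; congr EFin.
  pose g (r : {ffun F -> L}) : R := \prod_j (r j \in A (val j))%:R.
  transitivity (expect p (fun q : {ffun 'I_N.+1 -> L} => g [ffun j => q (tau j)])).
    apply: eq_bigr => q _; rewrite inE /g; case: ifPn => [/forallP qA|].
      by rewrite big1 ?mulr1// => j _; rewrite ffunE qA.
    move=> /forallPn[j /negbTE qj]; rewrite (bigD1 j)//= ffunE qj.
    by rewrite mul0r mulr0.
  rewrite (expect_local p_sum1 g (tau := tau)); last first.
    move=> j j' /(congr1 val)/= jj'; apply: val_inj.
    by apply: idx_inj; rewrite ?inE.
  rewrite (expect_prod p (fun (j : F) l => (l \in A (val j))%:R)).
  by rewrite big_seq_fsetE.
have mX_ : measurable_fun setT (X_ : _ -> borel X).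
  by apply: measurable_into_shift => // F A; case: (mX F A).
pose XX : {mfun measurableTypeR R >-> borel X} :=
  HB.pack X_ (isMeasurableFun.Build _ _ _ _ _ mX_).
exists (distribution (@unit_lebesgue R : probability _ _) XX) => F A.
by case: (mX F A).
Qed.

End ProductMeasure.

(** * Sofic approximations *)

Section LimsupRates.
Variable R : realType.
Implicit Types (u : nat -> \bar R) (a y : R).

Lemma limn_esup_le u (l : \bar R) :
  (\forall i \near \oo, (u i <= l)%E) -> (limn_esup u <= l)%E.
Proof.
move=> ul; apply: (@le_trans _ _ (ereal_sup (u @` [set i | (u i <= l)%E]))).
  by apply: ereal_inf_lbound; exists [set i | (u i <= l)%E].
by apply: ge_ereal_sup => _ [i ui <-].
Qed.

Lemma limn_esup_ge u (l : \bar R) :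
  (\forall i \near \oo, (l <= u i)%E) -> (l <= limn_esup u)%E.
Proof.
move=> lu; apply: le_ereal_inf_tmp => _ [V V_oo <-].
have [i [Vi li]] := filter_ex (filterI V_oo lu).
by apply: (le_trans li); apply: ereal_sup_ubound; exists i.
Qed.

Lemma rate_le (d : nat) (x : \bar R) y : (0 < d)%N ->
  (x <= (expR (d%:R * y))%:E)%E -> (((d%:R)^-1)%:E * lne x <= y%:E)%E.
Proof.
move=> d0 xy; have d_gt0 : 0 < d%:R^-1 :> R by rewrite invr_gt0 ltr0n.
(* Covers the absence of microstates, where [x = 0] and the rate is [-oo]. *)
have [x0|x0] := leP x 0%E.
  by rewrite le0_lneNy// gt0_muleNy ?lte_fin// leNye.
have : (lne x <= (d%:R * y)%:E)%E.
  rewrite -[leRHS]expeRK lee_lne// in_itv/= ?(ltW x0)/= ?leey//.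
  by rewrite lee_fin expR_ge0.
move=> /(lee_wpmul2l (ltW d_gt0 : (0 <= (d%:R^-1)%:E)%E)) /le_trans; apply.
by rewrite -EFinM lee_fin mulKf// pnatr_eq0 -lt0n.
Qed.

Lemma rate_ge (d : nat) (x : \bar R) y : (0 < d)%N ->
  ((expR (d%:R * y))%:E <= x)%E -> (y%:E <= ((d%:R)^-1)%:E * lne x)%E.
Proof.
move=> d0 xy; have d_gt0 : 0 < d%:R^-1 :> R by rewrite invr_gt0 ltr0n.
have x0 : (0 < x)%E by rewrite (lt_le_trans _ xy)// lte_fin expR_gt0.
have : ((d%:R * y)%:E <= lne x)%E.
  rewrite -[leLHS]expeRK lee_lne// in_itv/= ?(ltW x0)/= ?leey//.
  by rewrite lee_fin expR_ge0.
move=> /(lee_wpmul2l (ltW d_gt0 : (0 <= (d%:R^-1)%:E)%E)); apply: le_trans.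
by rewrite -EFinM lee_fin mulKf// pnatr_eq0 -lt0n.
Qed.

End LimsupRates.

(** * Rarity of the sites where multiplicativity or freeness fails *)

Section SoficEstimates.
Variables (R : realType) (G : groupType) (Sigma : sofic_approximation R G).
Local Notation d i := (sdim Sigma i).
Local Notation sg i := (@smap _ _ Sigma i).

Lemma near_sdim_ge (M : R) : \forall i \near \oo, M <= (d i)%:R.
Proof.
have /cvgnyPge/(_ (Num.truncn `|M|).+1) := @sdim_infty _ _ Sigma.
apply: filterS => i Mi; rewrite (le_trans (ler_norm _))//.
by rewrite (le_trans (ltW (truncnS_gt _)))// ler_nat.
Qed.

Lemma near_sdim_gt0 : \forall i \near \oo, (0 < d i)%N.
Proof. by apply: filterS (near_sdim_ge 1) => i; rewrite ler1n. Qed.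

Lemma near_predC_le (P : forall i, {pred 'I_(d i)}) (eta : R) : 0 < eta ->
  (#|P i|%:R / (d i)%:R : R) @[i --> \oo] --> (1 : R) ->
  \forall i \near \oo, #|predC (P i)|%:R <= eta * (d i)%:R.
Proof.
move=> eta0 /cvgrPdist_lt/(_ _ eta0) Pi.
near=> i.
have d0 : 0 < (d i)%:R :> R by rewrite ltr0n; near: i; exact: near_sdim_gt0.
have : `|1 - #|P i|%:R / (d i)%:R| < eta by near: i.
rewrite ltr_norml => /andP[_].
have := cardC (P i); rewrite card_ord => /(congr1 (fun n => n%:R : R)).
rewrite natrD => dE; rewrite -(ltr_pM2r d0) mulrBl mul1r divfK ?gt_eqF//.
by rewrite -dE; lra.
Unshelve. all: by end_near. Qed.

Lemma near_smap_mul (g h : G) (eta : R) : 0 < eta -> \forall i \near \oo,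
  #|[pred a | sg i (g * h)%g a != sg i g (sg i h a)]|%:R <= eta * (d i)%:R.
Proof. by move=> eta0; exact: near_predC_le (smap_mul Sigma g h). Qed.

Lemma near_smap_free (g h : G) (eta : R) : g != h -> 0 < eta ->
  \forall i \near \oo, #|[pred a | sg i g a == sg i h a]|%:R <= eta * (d i)%:R.
Proof.
move=> gh eta0; apply: filterS (near_predC_le eta0 (smap_free Sigma gh)) => i.
apply: le_trans; rewrite ler_nat; apply: subset_leq_card; apply/fintype.subsetP => a.
by rewrite !inE negbK.
Qed.

(** The inverse comes from the action: [x(w) = (w^-1 . x)(1)], and [w^-1 . phi(a)] is close to
    [phi(sigma(w^-1)(a))] for most [a] when [phi] is a good microstate. *)
Definition sofic_window (W : {fset G}) i (a : 'I_(d i)) (j : W) : 'I_(d i) :=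
  sg i (val j)^-1%g a.
Arguments sofic_window : clear implicits.

Lemma sofic_window_inj (W : {fset G}) i (j : W) : injective ((sofic_window W i)^~ j).
Proof. by move=> a b /perm_inj. Qed.

(** A union bound over pairs: a non-injective window at [a] means that [sigma(w^-1)] and
    [sigma(w'^-1)] agree at [a] for some [w != w'] in [W], which freeness makes rare. *)
Lemma near_num_noninjective (W : {fset G}) (eta : R) : 0 < eta ->
  \forall i \near \oo, (num_noninjective (sofic_window W i))%:R <= eta * (d i)%:R.
Proof.
move=> eta0; pose K : R := #|{: W * W}|%:R.
have eK : 0 < eta / (K + 1) by rewrite divr_gt0// ltr_wpDl// ler0n.
have : \forall i \near \oo, forall u : W * W, u.1 != u.2 ->
    #|[pred a | sofic_window W i a u.1 == sofic_window W i a u.2]|%:R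
    <= eta / (K + 1) * (d i)%:R.
  apply: filter_forall => u; have [u12|u12] := eqVneq u.1 u.2.
    by apply: nearW => i /=; rewrite u12 => /eqP.
  have inv12 : (val u.1)^-1%g != (val u.2)^-1%g.
    by apply: contra_neq u12 => /invg_inj /val_inj.
  by apply: filterS (near_smap_free inv12 eK) => i ui _.
apply: filterS => i ui.
apply: (@le_trans _ _ (\sum_(u : W * W) (eta / (K + 1) * (d i)%:R))).
  apply: (@le_trans _ _ (\sum_(u : W * W | u.1 != u.2)
    #|[pred a | sofic_window W i a u.1 == sofic_window W i a u.2]|%:R)); last first.
    rewrite big_mkcond/=; apply: ler_sum => u _.
    by case: ifPn => [/ui//|_]; rewrite mulr_ge0// ltW.
  rewrite -natr_sum ler_nat /num_noninjective -sum1_card.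
  under [X in (_ <= X)%N]eq_bigr do rewrite -sum1_card big_mkcond/=.
  rewrite exchange_big/= big_mkcond/=; apply: leq_sum => a _.
  case: ifPn => //; rewrite inE => /injectivePn[j [j' jj' jE]].
  by rewrite (bigD1 (j, j'))//= inE jE eqxx.
rewrite sumr_const -[X in X <= _]mulr_natl mulrA ler_wpM2r//.
rewrite -/K mulrCA ler_piMr ?(ltW eta0)// ler_pdivrMr ?mul1r ?lerDl//.
by rewrite ltr_wpDl// ler0n.
Qed.

End SoficEstimates.
Arguments sofic_window {R G} Sigma W i.

(** * Upper bounds *)

Section SeparatedSets.
Variables (R : realType) (G : groupType) (L : finPointedType).
Local Notation X := (shift_space G L).
Variable rho : X -> X -> R.
Hypothesis rhoP : compatible_metric rho.

(* For a good microstate the second component, which records the [W]-patterns,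
   is determined by the first one up to few errors. *)
Definition code (W : {fset G}) d (phi : 'I_d -> X) :
    {ffun 'I_d -> L} * {ffun 'I_d * W -> L} :=
  ([ffun a => phi a 1%g], [ffun v => phi v.1 (val v.2)]).

Lemma num_errors_codeE (W : {fset G}) d (sigma : G -> {perm 'I_d}) (phi : 'I_d -> X) :
  (num_errors (fun a (j : W) => sigma (val j)^-1%g a) (code W phi))%:R =
  \sum_a \sum_(j : W) (phi a (val j) != phi (sigma (val j)^-1%g a) 1%g)%:R :> R.
Proof.
rewrite (pair_bigA _ (fun a (j : W) =>
  (phi a (val j) != phi (sigma (val j)^-1%g a) 1%g)%:R))/=.
rewrite /num_errors -sum1_card natr_sum big_mkcond/=; apply: eq_bigr => v _.
by rewrite inE !ffunE/=; case: (_ != _).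
Qed.

(** The two terms at [a] can differ only if the pattern read off the labelling is not that of
    [phi a], which forces an error at [a]; the difference is at most 2. *)
Lemma local_sum_code (W W' : {fset G}) d (sigma : G -> {perm 'I_d})
    (g : {ffun W -> L} -> R) (phi : 'I_d -> X) :
  {subset W <= W'} -> (forall q, `|g q| <= 1) ->
  `|local_sum (fun a (j : W) => sigma (val j)^-1%g a) g (code W' phi).1
    - \sum_a g (pat W (phi a))|
  <= 2 * (num_errors (fun a (j : W') => sigma (val j)^-1%g a) (code W' phi))%:R.
Proof.
move=> WW' g1; rewrite num_errors_codeE -sumrB mulr_sumr.
apply: le_trans (ler_norm_sum _ _ _) _; apply: ler_sum => a _.
set q := [ffun _ => _]; have [->|/eqP qa] := eqVneq q (pat W (phi a)).
  by rewrite subrr normr0 mulr_ge0// sumr_ge0.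
have /existsP[j jq] : [exists j, q j != pat W (phi a) j].
  apply: contra_notT qa => /existsPn qa; apply/ffunP => j.
  by have /negPn/eqP := qa j.
apply: (@le_trans _ _ 2).
  by rewrite (le_trans (ler_normB _ _))// -[2]/(1 + 1) lerD.
rewrite ler_peMr// (bigD1 [` WW' _ (fsvalP j)]%fset)//=.
move: jq; rewrite !ffunE eq_sym => ->.
by rewrite lerDl sumr_ge0.
Qed.

(** Chebyshev's inequality: an error at [(a, w)] makes the labels at 1 of [phi(sigma(w^-1)(a))] and
    [w^-1 . phi(a)] differ, so their distance is at least [e], while [rho2] bounds the mean square
    distance by [delta^2]. *)
Lemma num_errors_code (W : {fset G}) (F : {fset G}) d (sigma : G -> {perm 'I_d})
    (delta e : R) (phi : 'I_d -> X) :
  (0 < d)%N -> 0 < e -> (forall y z, rho y z < e -> y 1%g = z 1%g) ->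
  (forall w, w \in W -> w^-1%g \in F) ->
  Map (@shift_action G L) rho F delta sigma phi ->
  (num_errors (fun a (j : W) => sigma (val j)^-1%g a) (code W phi))%:R
  <= #|{: W}|%:R * (delta / e) ^+ 2 * d%:R.
Proof.
move=> d0 e0 sep WF phiM; have [rho0 _ _ _ _] := rhoP.
pose r (j : W) a := rho (phi (sigma (val j)^-1%g a)) (shift_action (val j)^-1%g (phi a)).
have rP j : \sum_a (r j a / e) ^+ 2 <= (delta / e) ^+ 2 * d%:R.
  have := phiM _ (WF _ (fsvalP j)); rewrite /rho2.
  set S := _ * _ => Sd.
  have S0 : 0 <= S.
    by rewrite mulr_ge0 ?invr_ge0// sumr_ge0// => a _; rewrite sqr_ge0.
  have delta0 : 0 <= delta by rewrite ltW// (le_lt_trans (sqrtr_ge0 S)).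
  have : S <= delta ^+ 2.
    rewrite -(sqr_sqrtr S0) lerXn2r ?nnegrE ?sqrtr_ge0//; exact: ltW.
  rewrite /S mulrC ler_pdivrMr ?ltr0n// => Sd2.
  under eq_bigr do rewrite exprMn.
  by rewrite -mulr_suml exprMn mulrAC ler_wpM2r// exprn_ge0// invr_ge0 ltW.
rewrite num_errors_codeE.
rewrite exchange_big/=.
apply: (@le_trans _ _ (\sum_(j : W) (delta / e) ^+ 2 * d%:R)); last first.
  by rewrite sumr_const -[X in X <= _]mulr_natl mulrA.
apply: ler_sum => j _; apply: le_trans (rP j); apply: ler_sum => a _.
case: eqP => [_|ne]; first exact: sqr_ge0.
rewrite exprn_ege1// ler_pdivlMr// mul1r leNgt; apply/negP => /sep.
rewrite /shift_action invgK mulg1 => E.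
exact/ne/esym.
Qed.

(** Equal codes mean agreement on [W] at every site, hence [rho_infty] below [eps]. *)
Lemma code_inj (W : {fset G}) d eps (E : set ('I_d -> X)) : 0 < eps ->
  (forall y z, agree W y z -> rho y z < eps) -> eps_separated rho eps E ->
  {in E &, injective (code W (d := d))}.
Proof.
move=> eps0 We Esep phi psi /set_mem Ephi /set_mem Epsi [_ /ffunP codeE].
have [//|ne] := pselect (phi = psi).
have := Esep _ _ Ephi Epsi ne; rewrite leNgt => /negP[].
rewrite /rho_infty; apply/bigmax_ltP; split=> // a _; apply: We => g gW.
by have := codeE (a, [` gW]%fset); rewrite !ffunE.
Qed.

(** Codes of a separated set of good microstates are distinct and have few errors, so the sum is
    part of the one bounded by the hypothesis on codes. The weight [w] stays free: the pressure uses
    the plain weight, the entropy bound a tilted one. *)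
Lemma separated_bound (W F : {fset G}) d (sigma : G -> {perm 'I_d})
    (eps e kappa delta eta : R) (E : set ('I_d -> X)) (w : {ffun 'I_d -> L} -> R) :
  (0 < d)%N -> 0 < eps -> (forall y z, agree W y z -> rho y z < eps) ->
  0 < e -> (forall y z, rho y z < e -> y 1%g = z 1%g) ->
  (forall w, w \in W -> w^-1%g \in F) ->
  #|{: W}|%:R * (delta / e) ^+ 2 <= kappa ->
  (forall tau : 'I_d -> W -> 'I_d,
    \sum_(u | (num_errors tau u)%:R <= kappa * #|'I_d|%:R) w u.1
    <= expR (eta * #|'I_d|%:R) * \sum_psi w psi) ->
  (forall psi, 0 <= w psi) ->
  E `<=` Map (@shift_action G L) rho F delta sigma -> eps_separated rho eps E ->
  finite_set E /\ \sum_(phi <- fset_set E) w (code W phi).1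
    <= expR (eta * d%:R) * \sum_psi w psi.
Proof.
move=> d0 eps0 We e0 sep WF dk codes w0 EM Esep.
have inj := code_inj eps0 We Esep.
have Efin : finite_set E.
  have : finite_set (code W (d := d) @` E) by exact: finite_finset.
  by rewrite -(eq_finite_set (inj_card_eq inj)).
split=> //; pose tau a (j : W) := sigma (val j)^-1%g a.
rewrite -[X in eta * X%:R](card_ord d); apply: le_trans (codes tau).
rewrite -(big_map (code W (d := d)) xpredT (fun u => w u.1))/=.
rewrite big_uniq/=; last first.
  rewrite map_inj_in_uniq ?fset_uniq// => x y; rewrite !in_fset_set// => xE yE.
  exact: inj.
rewrite big_mkcond [leRHS]big_mkcond/=; apply: ler_sum => u _.
case: ifPn => [/mapP[phi]|_]; last by case: ifP.
rewrite in_fset_set// => /set_mem Ephi ->.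
rewrite ifT// (le_trans (num_errors_code d0 e0 sep WF (EM _ Ephi)))// card_ord.
by rewrite ler_wpM2r.
Qed.

End SeparatedSets.

Section Partition.
Variables (R : realType) (L : finPointedType) (f0 : L -> R).

Definition partition_function : R := \sum_l expR (f0 l).

Lemma partition_function_gt0 : 0 < partition_function.
Proof.
rewrite /partition_function (bigD1 (point : L))//= ltr_pwDl ?expR_gt0//.
by apply: sumr_ge0 => l _; exact: expR_ge0.
Qed.

Lemma expR_lnZ (d : nat) : expR (d%:R * ln partition_function) = partition_function ^+ d.
Proof. by rewrite expRM_natl lnK// posrE partition_function_gt0. Qed.

Lemma gibbs_weight_gt0 l : 0 < gibbs_weight f0 l.
Proof. by rewrite divr_gt0 ?expR_gt0// partition_function_gt0. Qed.

Lemma gibbs_weight_sum1 : \sum_l gibbs_weight f0 l = 1.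
Proof. by rewrite -mulr_suml divff// gt_eqF// partition_function_gt0. Qed.

Lemma expR_sum_labels (I : finType) (psi : {ffun I -> L}) :
  expR (\sum_a f0 (psi a)) = partition_function ^+ #|I| * pweight (gibbs_weight f0) psi.
Proof.
rewrite expR_sum /pweight big_split/= prodr_const exprVn mulrC divfK//.
by rewrite expf_neq0// gt_eqF// partition_function_gt0.
Qed.

Lemma sum_expR_labels (I : finType) (h : {ffun I -> L} -> R) :
  \sum_(psi : {ffun I -> L}) expR (\sum_a f0 (psi a)) * h psi
  = partition_function ^+ #|I| * expect (gibbs_weight f0) h.
Proof.
by rewrite /expect mulr_sumr; apply: eq_bigr => psi _; rewrite expR_sum_labels mulrA.
Qed.

End Partition.

(** Choose [delta / e <= t] with [t = min(1, kappa / (K + 1))] and use [t^2 <= t]. *)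
Lemma exists_ratio_sq_le (R : realType) (K e kappa eta : R) :
  0 <= K -> 0 < e -> 0 < kappa -> 0 < eta ->
  exists delta, 0 < delta <= eta /\ K * (delta / e) ^+ 2 <= kappa.
Proof.
move=> K0 e0 k0 eta0; have K1 : 0 < K + 1 by rewrite ltr_wpDl.
pose t := Num.min 1 (kappa / (K + 1)).
have t0 : 0 < t by rewrite lt_min ltr01 divr_gt0.
have t1 : t <= 1 by rewrite ge_min lexx.
have tk : t <= kappa / (K + 1) by rewrite ge_min lexx orbT.
exists (Num.min eta (e * t)); split.
  by rewrite lt_min eta0 mulr_gt0//= ge_min lexx.
have : Num.min eta (e * t) / e <= t by rewrite ler_pdivrMr// mulrC ge_min lexx orbT.
set s := _ / e => st.
have s0 : 0 <= s by rewrite divr_ge0 ?(ltW e0)// le_min ltW// mulr_ge0 ?ltW.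
move: tk; rewrite ler_pdivlMr// => tk.
have : s ^+ 2 <= t ^+ 2 by rewrite lerXn2r ?nnegrE// ltW.
have : t ^+ 2 <= t by rewrite expr2 ler_piMr// ltW.
nra.
Qed.

(** * Pressure bound and tilted entropy bound *)

Section UpperBounds.
Variables (R : realType) (G : groupType) (L : finPointedType) (f0 : L -> R).
Local Notation X := (shift_space G L).
Variables (Sigma : sofic_approximation R G) (rho : X -> X -> R).
Hypothesis rhoP : compatible_metric rho.
Local Notation d i := (sdim Sigma i).
Local Notation sg i := (@smap _ _ Sigma i).
Local Notation Z := (partition_function f0).
Local Notation p := (gibbs_weight f0).
Local Notation f := (fun x : X => f0 (x 1%g)).

Lemma continuous_potential : continuous f.
Proof.
move=> x A /nbhs_singleton fx; apply/shift_nbhsP; exists [fset 1%g]%fset => y xy /=.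
by rewrite -xy ?inE.
Qed.

Lemma pressure_le : (sofic_pressure (@shift_action G L) rho Sigma f <= (ln Z)%:E)%E.
Proof.
apply: ge_ereal_sup => _ [eps /= eps0 <-]; apply/lee_addgt0Pr => eta eta0.
have [W We] := metric_window rhoP eps0; have [e e0 sep] := metric_separates rhoP 1%g.
have [kappa /andP[k0 _] kP] := sum_codes L W eta0.
have [delta [/andP[delta0 _] dk]] := exists_ratio_sq_le (ler0n R #|{: W}|) e0 k0 eta0.
pose F := [fset w^-1%g | w in W]%fset.
have WF w : w \in W -> w^-1%g \in F by move=> wW; apply/imfsetP; exists w.
apply: ge_ereal_inf; eexists; first by exists F.
apply: ge_ereal_inf; eexists; first by exists delta.
apply: limn_esup_le; apply: filterS (near_sdim_gt0 Sigma) => i d0.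
rewrite -EFinD; apply: rate_le => //; apply: ge_ereal_sup => _ [E [EM Esep] <-].
pose w (psi : {ffun 'I_(d i) -> L}) := expR (\sum_a f0 (psi a)).
have w0 psi : 0 <= w psi by exact: expR_ge0.
have [Efin Esum] := separated_bound rhoP d0 eps0 We e0 sep WF dk
  (fun tau => kP _ tau w w0) w0 EM Esep.
rewrite esum_fset//.
rewrite fsbig_finite//= sumEFin lee_fin.
have -> : \sum_(phi <- fset_set E) expR (\sum_(a < d i) f0 (phi a 1%g)) =
    \sum_(phi <- fset_set E) w (code W phi).1.
  by apply: eq_bigr => phi _; congr expR; apply: eq_bigr => a _; rewrite ffunE.
apply: (le_trans Esum).
have -> : \sum_psi w psi = Z ^+ d i.
  have := sum_expR_labels f0 (fun _ : {ffun 'I_(d i) -> L} => 1).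
  rewrite expect_cst ?gibbs_weight_sum1// mulr1 card_ord => <-.
  by apply: eq_bigr => psi _; rewrite mulr1.
by rewrite -expR_lnZ -expRD ler_expR; lra.
Qed.

(* Derivative argument: [s] is the size of a perturbation of the potential by
   [g], and the error is quadratic in [s]. *)
Lemma entropy_le (mu : probability (borel X) R) (W : {fset G})
    (g : {ffun W -> L} -> R) (s : R) :
  (forall q, `|g q| <= 1) -> `|s| <= 1 -> `|s| * #|{: W}|%:R <= 4^-1 ->
  (sofic_entropy (@shift_action G L) rho Sigma mu <=
   (ln Z - \int[mu]_x f x - s * (\int[mu]_x g (pat W x) - expect p g)
    + 8 * (s * #|{: W}|%:R) ^+ 2)%:E)%E.
Proof.
move=> g1 s1 sW.
have p0 l : 0 <= p l by rewrite ltW ?gibbs_weight_gt0.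
apply: ge_ereal_sup => _ [eps /= eps0 <-]; apply/lee_addgt0Pr => eta' eta'0.
(* The losses are [eta] from the codes, [4 eta] in [wlow] and [2 eta] in [wsum]. *)
pose eta := eta' / 7; have eta0 : 0 < eta by rewrite divr_gt0.
have [W0 W0e] := metric_window rhoP eps0; have [e e0 sep] := metric_separates rhoP 1%g.
pose W' := (W `|` W0)%fset.
have WW' : {subset W <= W'} by move=> x xW; rewrite in_fsetU xW.
have We y z : agree W' y z -> rho y z < eps.
  by move=> yz; apply: W0e; apply: agree_sub yz => x xW; rewrite in_fsetU xW orbT.
have [kappa /andP[k0 keta] kP] := sum_codes L W' eta0.
have [delta [/andP[delta0 deta] dk]] := exists_ratio_sq_le (ler0n R #|{: W'}|) e0 k0 eta0.
pose F := [fset w^-1%g | w in W']%fset.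
have WF w : w \in W' -> w^-1%g \in F by move=> wW; apply/imfsetP; exists w.
pose gW := fun x : X => g (pat W x).
have cf := continuous_potential.
apply: ge_ereal_inf; eexists; first by exists F.
apply: ge_ereal_inf; eexists.
  exists [fset f; gW]%fset => //= u; rewrite !inE => /orP[]/eqP -> //.
  exact: continuous_pat.
apply: ge_ereal_inf; eexists; first by exists delta.
apply: limn_esup_le.
have := near_num_noninjective Sigma W eta0.
apply: filterS2 (near_sdim_gt0 Sigma) => i d0 nbadW.
rewrite -EFinD; apply: rate_le => //; apply: ge_ereal_sup => _ [E [EM Esep] <-].
have dR : 0 < (d i)%:R :> R by rewrite ltr0n.
pose tau := sofic_window Sigma W i.
pose w (psi : {ffun 'I_(d i) -> L}) :=
  expR (\sum_a f0 (psi a)) * expR (s * local_sum tau g psi).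
have w0 psi : 0 <= w psi by rewrite mulr_ge0 ?expR_ge0.
have [Efin Esum] := separated_bound rhoP d0 eps0 We e0 sep WF dk
  (fun tau => kP _ tau w w0) w0 (fun phi Ephi => (EM phi Ephi).1) Esep.
rewrite /counting asboolT// lee_fin.
pose If := \int[mu]_x f x; pose Ig := \int[mu]_x gW x.
(* The average of [f] loses [eta]. As [|s| <= 1], the tilt loses at most [3 eta]: [eta] from the
   average of [gW] and [2 eta] from the errors of the code. *)
have wlow phi : E phi ->
    expR ((d i)%:R * (If + s * Ig - 4 * eta)) <= w (code W' phi).1.
  move=> Ephi; have [phiM phiu] := EM phi Ephi.
  have avg u : u \in [fset f; gW]%fset ->
      `|\sum_a u (phi a) - (d i)%:R * \int[mu]_x u x| <= (d i)%:R * eta.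
    move=> /phiu; rewrite -(ltr_pM2l dR) -[X in X * `|_|](gtr0_norm dR) -normrM.
    rewrite mulrBr mulVKf ?gt_eqF// => /ltW/le_trans; apply.
    by rewrite ler_wpM2l// ltW.
  have := avg f; rewrite !inE eqxx => /(_ isT); rewrite ler_norml => /andP[fl _].
  have := avg gW; rewrite !inE eqxx orbT => /(_ isT) gl.
  have nerrP := num_errors_code rhoP d0 e0 sep WF phiM.
  have lsP := local_sum_code (sg i) phi WW' g1.
  rewrite /w -expRD ler_expR.
  have -> : \sum_a f0 ((code W' phi).1 a) = \sum_a f0 (phi a 1%g).
    by apply: eq_bigr => a _; rewrite ffunE.
  have slow : - (3 * eta * (d i)%:R) <=
      s * (local_sum tau g (code W' phi).1 - (d i)%:R * Ig).
    have : `|s * (local_sum tau g (code W' phi).1 - (d i)%:R * Ig)|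
        <= 3 * eta * (d i)%:R.
      rewrite normrM; apply: (@le_trans _ _ (1 * (3 * eta * (d i)%:R))).
        rewrite ler_pM//.
        rewrite -(subrKA (\sum_a gW (phi a))) (le_trans (ler_normD _ _))//.
        have : 2 * (num_errors (fun a (j : W') => sg i (val j)^-1%g a) (code W' phi))%:R
            <= 2 * (eta * (d i)%:R).
          rewrite ler_wpM2l// (le_trans nerrP)// ler_wpM2r//.
          exact: le_trans dk keta.
        move: lsP gl; rewrite /gW -/Ig; lra.
      by rewrite mul1r.
    by rewrite ler_norml => /andP[].
  move: fl slow; rewrite -/If; nra.
have wsum : \sum_psi w psi <=
    expR ((d i)%:R * (ln Z + s * expect p g + 2 * eta + 8 * (s * #|{: W}|%:R) ^+ 2)).
  rewrite sum_expR_labels card_ord -expR_lnZ.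
  apply: (@le_trans _ _ (expR ((d i)%:R * ln Z) *
    expR (s * ((d i)%:R * expect p g) + 2 * `|s| * (num_noninjective tau)%:R
           + 8 * (s * #|{: W}|%:R) ^+ 2 * (d i)%:R))).
    rewrite ler_wpM2l ?expR_ge0//.
    have := @expect_expR_local_sum R L 'I_(d i) {: W} p p0 (gibbs_weight_sum1 f0)
      tau g (@sofic_window_inj _ _ Sigma W i) g1 s sW.
    by rewrite card_ord.
  rewrite -expRD ler_expR.
  have : `|s| * (num_noninjective tau)%:R <= 1 * (eta * (d i)%:R) by rewrite ler_pM.
  nra.
(* The cardinality of [E] times the lower bound [wlow] is at most the weighted sum over [E]. *)
rewrite -(@ler_pM2r _ (expR ((d i)%:R * (If + s * Ig - 4 * eta)))) ?expR_gt0//.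
apply: (@le_trans _ _ (\sum_(phi <- fset_set E) w (code W' phi).1)).
  rewrite -sum1_size natr_sum mulr_suml big_seq [leRHS]big_seq; apply: ler_sum => phi.
  by rewrite in_fset_set// => /set_mem Ephi; rewrite mul1r wlow.
apply: (le_trans Esum); apply: (le_trans (ler_wpM2l (expR_ge0 _) wsum)).
rewrite -!expRD ler_expR -/gW -/If -/Ig /eta.
by rewrite le_eqVlt; apply/orP; left; apply/eqP; field.
Qed.

End UpperBounds.

(** * Lower bounds *)

Section LowerBounds.
Variables (R : realType) (G : groupType) (L : finPointedType) (f0 : L -> R).
Local Notation X := (shift_space G L).
Variables (Sigma : sofic_approximation R G) (rho : X -> X -> R).
Hypothesis rhoP : compatible_metric rho.
Local Notation d i := (sdim Sigma i).
Local Notation sg i := (@smap _ _ Sigma i).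
Local Notation Z := (partition_function f0).
Local Notation p := (gibbs_weight f0).
Local Notation f := (fun x : X => f0 (x 1%g)).

(* The microstate obtained by pulling a labelling back along the sofic
   approximation. *)
Definition model i (psi : {ffun 'I_(d i) -> L}) : 'I_(d i) -> X :=
  fun a h => psi (sg i h^-1%g a).

(** [sigma(1)] is a permutation, though perhaps not the identity, so each label [psi b] is the label
    at 1 of the model at some site. *)
Lemma model_separated e i psi psi' :
  (forall y z, rho y z < e -> y 1%g = z 1%g) -> 0 < e ->
  psi <> psi' -> e <= rho_infty rho (@model i psi) (model psi').
Proof.
move=> sep e0 ne; rewrite leNgt; apply/negP => /bigmax_ltP[_ re].
apply: ne; apply/ffunP => b.
have := sep _ _ (re ((sg i 1^-1%g)^-1%g b) isT).
by rewrite /model permKV.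
Qed.

Lemma model_inj i : injective (@model i).
Proof.
move=> psi psi' E; apply/ffunP => b.
have := congr1 (fun h : 'I_(d i) -> X => h ((sg i 1^-1%g)^-1%g b) 1%g) E.
by rewrite /model permKV.
Qed.

Lemma sum_model i psi : \sum_a f (@model i psi a) = \sum_a f0 (psi a).
Proof. by rewrite [RHS](reindex_inj (@perm_inj _ (sg i 1^-1%g))). Qed.

(** At position [w] the two configurations read [psi] at [sigma(w^-1)(sigma(s)(a))] and at
    [sigma(w^-1 s)(a)], which coincide for most [a]. If this holds for all [w] in [W] the square
    distance is at most [(delta / 2)^2]; otherwise it is at most [B^2]. *)
Lemma near_model_Map (F : {fset G}) (delta : R) : 0 < delta ->
  \forall i \near \oo, forall psi,
    Map (@shift_action G L) rho F delta (sg i) (@model i psi).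
Proof.
move=> delta0; have [rho0 _ _ _ _] := rhoP.
have [B B0 rhoB] := metric_bounded rhoP.
have d2 : 0 < delta / 2 by rewrite divr_gt0.
have [W We] := metric_window rhoP d2.
pose K : R := #|{: W}|%:R.
have K0 : 0 <= K by exact: ler0n.
(* Makes the contribution [B^2 * eta * K] of the bad sites at most [delta^2 / 4]. *)
pose eta := delta ^+ 2 / (4 * B ^+ 2 * (K + 1)).
have den0 : 0 < 4 * B ^+ 2 * (K + 1).
  by rewrite !mulr_gt0 ?exprn_gt0// ltr_wpDl.
have eta0 : 0 < eta by rewrite divr_gt0// exprn_gt0.
have : \forall i \near \oo, forall u : F * W,
    #|[pred a | sg i ((val u.2)^-1 * val u.1)%g a
        != sg i (val u.2)^-1%g (sg i (val u.1) a)]|%:R <= eta * (d i)%:R.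
  by apply: filter_forall => u; exact: near_smap_mul.
apply: filterS2 (near_sdim_gt0 Sigma) => i d0 badle psi s sF.
have dR : 0 < (d i)%:R :> R by rewrite ltr0n.
pose bad a (j : W) := sg i ((val j)^-1 * s)%g a != sg i (val j)^-1%g (sg i s a).
have rho_le a : rho (model psi (sg i s a)) (shift_action s (model psi a)) ^+ 2
    <= (delta / 2) ^+ 2 + \sum_j B ^+ 2 * (bad a j)%:R.
  have [/existsP[j ja]|/existsPn good] := boolP [exists j, bad a j].
    rewrite ler_wpDl ?sqr_ge0// (bigD1 j)//= ja mulr1 ler_wpDr//.
      by rewrite sumr_ge0// => k _; rewrite mulr_ge0// sqr_ge0.
    by rewrite lerXn2r ?nnegrE// ltW.
  rewrite ler_wpDr//.
    by rewrite sumr_ge0// => k _; rewrite mulr_ge0// sqr_ge0.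
  rewrite lerXn2r ?nnegrE ?(ltW d2)//; apply/ltW/We => g gW.
  have := good [` gW]%fset; rewrite /bad negbK/= => /eqP E.
  by rewrite /model /shift_action /= invgM invgK -E.
have sum_le : (d i)%:R^-1 * \sum_(a < d i)
    rho (model psi (sg i s a)) (shift_action s (model psi a)) ^+ 2 <= delta ^+ 2 / 2.
  rewrite mulrC ler_pdivrMr//.
  apply: (le_trans (ler_sum _ (fun a _ => rho_le a))).
  rewrite big_split/= sumr_const card_ord exchange_big/=.
  apply: (@le_trans _ _ ((delta / 2) ^+ 2 *+ d i +
    \sum_(j : W) B ^+ 2 * (eta * (d i)%:R))).
    rewrite lerD2l; apply: ler_sum => j _; rewrite -mulr_sumr ler_wpM2l ?sqr_ge0//.
    apply: le_trans (badle ([` sF]%fset, j)).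
    by rewrite -natr_sum ler_nat -sum1_card [leqRHS]big_mkcond/=.
  rewrite sumr_const -[(delta / 2) ^+ 2 *+ _]mulr_natr -[(B ^+ 2 * _) *+ _]mulr_natr -/K.
  have etaE : B ^+ 2 * eta * K <= delta ^+ 2 / 4.
    have -> : B ^+ 2 * eta * K = delta ^+ 2 / 4 * (K / (K + 1)).
      by rewrite /eta; field; rewrite !gt_eqF// ltr_wpDl.
    rewrite ler_piMr ?divr_ge0 ?sqr_ge0// ler_pdivrMr ?mul1r ?lerDl//.
    by rewrite ltr_wpDl.
  nra.
rewrite /rho2 -(ger0_norm (ltW delta0)) -sqrtr_sqr ltr_sqrt ?exprn_gt0//.
rewrite (le_lt_trans sum_le)//.
have : 0 < delta ^+ 2 by rewrite exprn_gt0.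
lra.
Qed.

Lemma pressure_ge : ((ln Z)%:E <= sofic_pressure (@shift_action G L) rho Sigma f)%E.
Proof.
have [e e0 sep] := metric_separates rhoP 1%g.
apply: le_ereal_sup_tmp; eexists; first by exists e.
apply: le_ereal_inf_tmp => _ [F _ <-].
apply: le_ereal_inf_tmp => _ [delta /= delta0 <-].
apply: limn_esup_ge; apply: filterS2 (near_sdim_gt0 Sigma) (near_model_Map F delta0).
move=> i d0 modelM; apply: rate_ge => //.
apply: le_ereal_sup_tmp; eexists.
  exists (range (@model i)) => //; split; first by move=> _ [psi _ <-]; exact: modelM.
  move=> _ _ [psi _ <-] [psi' _ <-] ne; apply: model_separated => //.
  by move=> E; apply: ne; rewrite E.
rewrite esum_image; last by move=> psi psi' _ _; exact: model_inj.
rewrite esum_fset; [|exact: finite_finset|by move=> psi _; rewrite lee_fin expR_ge0].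
rewrite (_ : [set: _] = [set` index_enum {ffun 'I_(d i) -> L}]); last first.
  by apply/seteqP; split=> // psi _; rewrite /= mem_index_enum.
rewrite -fsbig_seq ?index_enum_uniq// sumEFin lee_fin expR_lnZ.
have := sum_expR_labels f0 (fun _ : {ffun 'I_(d i) -> L} => 1).
rewrite expect_cst ?gibbs_weight_sum1// mulr1 card_ord => <-.
by apply: ler_sum => psi _; rewrite mulr1 sum_model.
Qed.

End LowerBounds.

(** * Concentration of empirical averages of random labellings *)

Section LawOfLargeNumbers.
Variables (R : realType) (G : groupType) (L : finPointedType) (p : L -> R).
Hypotheses (p_ge0 : forall l, 0 <= p l) (p_sum1 : \sum_l p l = 1).
Local Notation X := (shift_space G L).
Variable Sigma : sofic_approximation R G.
Local Notation d i := (sdim Sigma i).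
Local Notation sg i := (@smap _ _ Sigma i).
Local Notation tau W i := (sofic_window Sigma W i).

(** A Chernoff bound: the indicator is at most an exponential of [s] times the excess, whose
    expectation the bounded differences inequality controls. *)
Lemma near_local_sum_ge (W : {fset G}) (g : {ffun W -> L} -> R) (gamma theta : R) :
  (forall q, `|g q| <= 1) -> 0 < gamma -> 0 < theta ->
  \forall i \near \oo,
    expect p (fun psi =>
      ((d i)%:R * (expect p g + gamma) <= local_sum (tau W i) g psi)%R%:R)
    <= theta.
Proof.
move=> g1 gamma0 theta0.
(* Lowering [gamma] enlarges the event, and [gamma <= 1] ensures [s * K <= 1/4]. *)
wlog gamma1 : gamma gamma0 / gamma <= 1.
  move=> wl; have m0 : 0 < Num.min 1 gamma by rewrite lt_min ltr01.
  have := wl _ m0; rewrite ge_min lexx => /(_ isT); apply: filterS => i.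
  apply: le_trans; apply: le_expect => // psi; rewrite ler_nat.
  case: (leP _ (local_sum _ _ _)) => //= le1; rewrite (le_trans _ le1)//.
  by rewrite ler_wpM2l// lerD2l ge_min lexx orbT.
pose K : R := #|{: W}|%:R; have K0 : 0 <= K by exact: ler0n.
have K1 : 0 < K + 1 by rewrite ltr_wpDl.
(* From the gain [s * gamma], the quadratic term and the non-injective windows each take at most a
   quarter, leaving the rate [s * gamma / 2]. *)
pose s := gamma / (32 * (K + 1) ^+ 2).
have s0 : 0 < s by rewrite divr_gt0// mulr_gt0// exprn_gt0.
have sE : 32 * s * (K + 1) ^+ 2 = gamma by rewrite /s; field; rewrite gt_eqF.
have sK : s * K <= 4^-1 by nra.
have sK2 : 8 * (s * K) ^+ 2 <= s * gamma / 4 by rewrite -sE; nra.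
have eta0 : 0 < gamma / 8 by rewrite divr_gt0.
have rate0 : 0 < s * gamma / 2 by rewrite divr_gt0// mulr_gt0.
apply: filterS2 (near_num_noninjective Sigma W eta0)
  (near_sdim_ge Sigma ((s * gamma / 2)^-1 * theta^-1)) => i badle dge.
apply: (@le_trans _ _ (expect p (fun psi =>
    expR (- (s * ((d i)%:R * (expect p g + gamma)))) *
    expR (s * local_sum (tau W i) g psi)))).
  apply: le_expect => // psi; case: (leP _ (local_sum _ _ _)) => [le1|_] /=.
    by rewrite -expRD -[leLHS]expR0 ler_expR addrC subr_ge0 ler_wpM2l// ltW.
  by rewrite mulr_ge0 ?expR_ge0.
rewrite expectZ; apply: (@le_trans _ _ (expR (- (s * gamma / 2 * (d i)%:R)))); last first.
  have d0 : 0 < (d i)%:R :> R.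
    by rewrite (lt_le_trans _ dge)// mulr_gt0 ?invr_gt0.
  have sd0 := mulr_gt0 rate0 d0.
  rewrite expRN; apply: (@le_trans _ _ ((s * gamma / 2 * (d i)%:R)^-1)).
    rewrite lef_pV2 ?posrE ?expR_gt0//.
    by rewrite (le_trans _ (expR_ge1Dx _))// lerDr.
  by rewrite -[leRHS]invrK lef_pV2 ?posrE ?invr_gt0// -(ler_pdivrMl _ _ rate0).
have sK' : `|s| * #|{: W}|%:R <= 4^-1 by rewrite gtr0_norm.
have := expect_expR_local_sum p_ge0 p_sum1 (@sofic_window_inj _ _ Sigma W i) g1 sK'.
rewrite card_ord gtr0_norm// -/K.
move=> /(ler_wpM2l (expR_ge0 (- (s * ((d i)%:R * (expect p g + gamma)))))).
move/le_trans; apply; rewrite -expRD ler_expR.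
have : s * (num_noninjective (tau W i))%:R <= s * (gamma / 8 * (d i)%:R).
  by rewrite ler_wpM2l// ltW.
have : 8 * (s * K) ^+ 2 * (d i)%:R <= s * gamma / 4 * (d i)%:R by rewrite ler_wpM2r.
nra.
Qed.

Lemma near_local_deviation (W : {fset G}) (g : {ffun W -> L} -> R) (gamma theta : R) :
  (forall q, `|g q| <= 1) -> 0 < gamma -> 0 < theta ->
  \forall i \near \oo,
    expect p (fun psi =>
      ((d i)%:R * gamma <= `|local_sum (tau W i) g psi - (d i)%:R * expect p g|)%R%:R)
    <= theta.
Proof.
move=> g1 gamma0 theta0; have t2 : 0 < theta / 2 by rewrite divr_gt0.
have g1' q : `|- g q| <= 1 by rewrite normrN.
apply: filterS2 (near_local_sum_ge g1 gamma0 t2) (near_local_sum_ge g1' gamma0 t2).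
move=> i le1 le2; apply: (@le_trans _ _ (theta / 2 + theta / 2)); last by lra.
apply: le_trans (lerD le1 le2); rewrite -expectD; apply: le_expect => // psi.
have -> : expect p (fun q => - g q) = - expect p g.
  by rewrite -mulN1r -expectZ; apply: eq_expect => q; rewrite mulN1r.
have -> : local_sum (tau W i) (fun q => - g q) psi = - local_sum (tau W i) g psi.
  by rewrite /local_sum sumrN.
set S := local_sum _ _ _; set m := expect p g; set D := (d i)%:R.
rewrite -natrD ler_nat.
case: (leP (D * gamma)) => // + ; rewrite ler_normr => /orP[] h.
  by have -> : D * (m + gamma) <= S by lra.
have -> : D * (- m + gamma) <= - S by lra.
 by case: (_ <= S).
Qed.

Variable nu : probability (borel X) R.
Hypothesis nuP : forall F A, nu (cyl F A) =
  (\prod_(g <- F) \sum_l p l * (l \in A g)%:R)%:E.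

Lemma product_Rintegral (W : {fset G}) (g : {ffun W -> L} -> R) :
  \int[nu]_x g (pat W x) = expect p g.
Proof.
rewrite (Rintegral_pat nu); apply: eq_bigr => q _; rewrite mulrC nuP/=; congr (_ * _).
rewrite big_seq_fsetE/=; apply: eq_bigr => j _.
rewrite (bigD1 (q j))//= big1 => [|l lq].
  by rewrite addr0 mem_set ?mulr1//= -(extK q) ffunE extK.
rewrite memNset ?mulr0//= => lE; move: lq.
by rewrite lE -{2}(extK q) ffunE eqxx.
Qed.

(** [u] is within [delta / 4] of a window function, scaled by [M + 1] so that [|g| <= 1]. Replacing
    [u] in the average and in the integral costs [delta / 2], and the rest must come from a
    deviation of [local_sum]. *)
Lemma near_model_average (u : X -> R) (delta theta : R) : continuous u ->
  0 < delta -> 0 < theta ->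
  \forall i \near \oo,
    expect p (fun psi => (delta <=
      `|(d i)%:R^-1 * \sum_(a < d i) u (@model _ _ _ Sigma i psi a)
        - \int[nu]_x u x|)%R%:R)
    <= theta.
Proof.
move=> cu delta0 theta0; have [M uM] := continuous_bounded cu.
have M0 : 0 <= M := le_trans (normr_ge0 _) (uM point).
have M1 : 0 < M + 1 by rewrite ltr_wpDl.
have d4 : 0 < delta / 4 by rewrite divr_gt0.
have [W We] := uniform_window cu d4.
pose g q := (M + 1)^-1 * u (@ext _ _ W q).
have uE q : u (@ext _ _ W q) = (M + 1) * g q by rewrite /g mulVKf ?gt_eqF.
have g1 q : `|g q| <= 1.
  rewrite normrM gtr0_norm ?invr_gt0// mulrC ler_pdivrMr// mul1r.
  by rewrite (le_trans (uM _))// lerDl.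
pose gamma := delta / (2 * (M + 1)).
have gamma0 : 0 < gamma by rewrite divr_gt0// mulr_gt0.
have intE : `|\int[nu]_x u x - (M + 1) * expect p g| <= delta / 4.
  rewrite -expectZ -(product_Rintegral (fun q => (M + 1) * g q)).
  have cv := @continuous_pat G L R W (fun q => (M + 1) * g q).
  apply: (Rintegral_close nu cu cv).
  by move=> x; rewrite -uE ltW// We//; exact: agree_ext.
apply: filterS2 (near_sdim_gt0 Sigma) (near_local_deviation g1 gamma0 theta0) => i d0.
apply: le_trans; apply: le_expect => // psi; rewrite ler_nat.
have dR : 0 < (d i)%:R :> R by rewrite ltr0n.
case: (leP delta) => //=; set A := _ * \sum_a _ => dA.
have AE : `|A - (M + 1) * ((d i)%:R^-1 * local_sum (tau W i) g psi)| <= delta / 4.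
  rewrite /A mulrCA -mulrBr normrM gtr0_norm ?invr_gt0// mulrC ler_pdivrMr//.
  rewrite mulr_sumr -sumrB (le_trans (ler_norm_sum _ _ _))//.
  rewrite mulr_natr -[X in _ *+ X](card_ord (d i)) -sumr_const; apply: ler_sum => a _.
  rewrite (_ : [ffun j => _] = pat W (model psi a)) -?uE.
    by rewrite ltW// We//; exact: agree_ext.
  by apply/ffunP => j; rewrite !ffunE.
have big : delta / 2 <=
    `|(M + 1) * ((d i)%:R^-1 * local_sum (tau W i) g psi) - (M + 1) * expect p g|.
  have := ler_normD (A - (M + 1) * ((d i)%:R^-1 * local_sum (tau W i) g psi))
    ((M + 1) * ((d i)%:R^-1 * local_sum (tau W i) g psi) - \int[nu]_x u x).
  rewrite subrKA.
  have := ler_normB (\int[nu]_x u x - (M + 1) * expect p g)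
    ((M + 1) * ((d i)%:R^-1 * local_sum (tau W i) g psi) - (M + 1) * expect p g).
  rewrite opprB addrA subrK distrC.
  lra.
suff -> : (d i)%:R * gamma <= `|local_sum (tau W i) g psi - (d i)%:R * expect p g| by [].
move: big; rewrite -mulrBr normrM gtr0_norm// => big.
have -> : local_sum (tau W i) g psi - (d i)%:R * expect p g =
    (d i)%:R * ((d i)%:R^-1 * local_sum (tau W i) g psi - expect p g).
  by rewrite mulrBr mulVKf ?gt_eqF.
rewrite normrM gtr0_norm// ler_wpM2l// /gamma ler_pdivrMr ?mulr_gt0//.
move: big; lra.
Qed.

End LawOfLargeNumbers.

Lemma counting_ge (R : realType) (T : choiceType) (S : set T) (s : seq T) :
  uniq s -> {subset s <= S} -> ((size s)%:R%:E <= counting S :> \bar R)%E.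
Proof.
move=> us sS; rewrite /counting; case: asboolP => [finS|_]; last exact: leey.
rewrite lee_fin ler_nat; apply: uniq_leq_size => // x /sS xS.
by rewrite in_fset_set.
Qed.

Section ProductMeasureEntropy.
Variables (R : realType) (G : groupType) (L : finPointedType) (f0 : L -> R).
Local Notation X := (shift_space G L).
Local Notation Z := (partition_function f0).
Local Notation p := (gibbs_weight f0).
Local Notation f := (fun x : X => f0 (x 1%g)).

Variable nu : probability (borel X) R.
Hypothesis nuP : forall F A, nu (cyl F A) =
  (\prod_(g <- F) \sum_l p l * (l \in A g)%:R)%:E.

Variables (Sigma : sofic_approximation R G) (rho : X -> X -> R).
Hypothesis rhoP : compatible_metric rho.
Local Notation d i := (sdim Sigma i).

(** The typical labellings [T] have probability at least 1/2, and each has weight at most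
    [exp(d (If + eta / 2 - ln Z))], so there are at least [exp(d (ln Z - If - eta))] of them. Their
    models are separated. *)
Lemma entropy_ge : ((ln Z - \int[nu]_x f x)%:E <=
  sofic_entropy (@shift_action G L) rho Sigma nu)%E.
Proof.
have p0 l : 0 <= p l by rewrite ltW ?gibbs_weight_gt0.
have p1 := gibbs_weight_sum1 f0.
have [e e0 sep] := metric_separates rhoP 1%g.
apply: le_ereal_sup_tmp; eexists; first by exists e.
apply: le_ereal_inf_tmp => _ [F _ <-].
apply: le_ereal_inf_tmp => _ [E /= cE <-].
apply: le_ereal_inf_tmp => _ [delta /= delta0 <-].
apply/lee_subgt0Pr => eta eta0; rewrite -EFinB.
set If := \int[nu]_x f x.
(* Testing [f] as well, with tolerance [eta / 2], controls the weight of each typical labelling. *)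
pose E' := (f |` E)%fset; pose delta' := Num.min delta (eta / 2).
have delta'0 : 0 < delta' by rewrite lt_min delta0 divr_gt0.
pose K : R := #|{: E'}|%:R; have K0 : 0 <= K by exact: ler0n.
have K1 : 0 < 2 * (K + 1) by rewrite mulr_gt0// ltr_wpDl.
(* With this probability for each test function, the union bound over [E'] leaves out at most
   1/2. *)
have theta0 : 0 < (2 * (K + 1))^-1 by rewrite invr_gt0.
have cE' (u : E') : continuous (val u : X -> R).
  have := fsvalP u; rewrite !inE => /orP[/eqP uf|/cE//].
  by have -> : val u = f := uf; exact: continuous_potential.
pose dev i (u : E') psi :=
  `|(d i)%:R^-1 * \sum_(a < d i) (val u) (@model _ _ _ Sigma i psi a)
  - \int[nu]_x (val u) x|.
have near_dev : \forall i \near \oo, forall u : E',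
    expect p (fun psi => (delta' <= dev i u psi)%R%:R) <= (2 * (K + 1))^-1.
  apply: filter_forall => u.
  exact: (near_model_average p0 p1 Sigma nuP (cE' u) delta'0 theta0).
apply: limn_esup_ge.
apply: filterS3 (near_sdim_ge Sigma (2 / eta)) near_dev
  (near_model_Map Sigma rhoP F delta0) => i dge devle modelM.
have dR : 0 < (d i)%:R :> R by rewrite (lt_le_trans _ dge)// divr_gt0.
have d0 : (0 < d i)%N by rewrite -(ltr0n R).
pose T := [pred psi : {ffun 'I_(d i) -> L} | [forall u : E', dev i u psi < delta']].
have half : 2^-1 <= expect p (fun psi => (psi \in T)%:R).
  have : 1 <= expect p (fun psi => (psi \in T)%:R)
      + \sum_(u : E') expect p (fun psi => (delta' <= dev i u psi)%R%:R).
    rewrite -expect_sum -expectD -[X in X <= _](@expect_cst R L 'I_(d i) p p1 1).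
    apply: le_expect => // psi.
    have [|] := boolP (psi \in T); first by rewrite lerDl sumr_ge0.
    rewrite inE => /forallPn[u]; rewrite -leNgt => ud.
    by rewrite add0r (bigD1 u)//= ud lerDl sumr_ge0.
  have : \sum_(u : E') expect p (fun psi => (delta' <= dev i u psi)%R%:R) <= 2^-1.
    apply: (le_trans (ler_sum _ (fun u _ => devle u))).
    rewrite sumr_const -[X in X <= _]mulr_natl -/K ler_pdivrMr//; lra.
  lra.
have Tdev psi u : psi \in T -> dev i u psi < delta' by rewrite inE => /forallP.
have Tf psi : psi \in T -> pweight p psi <= expR ((d i)%:R * (If + eta / 2 - ln Z)).
  move=> psiT; have fE : f \in E' by rewrite !inE eqxx.
  have := Tdev psi [` fE]%fset psiT; rewrite /dev/= -/If sum_model.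
  move=> fd.
  have : \sum_a f0 (psi a) <= (d i)%:R * (If + eta / 2).
    rewrite -ler_pdivrMl// -lerBlDl (le_trans (ler_norm _))// ltW//.
    by rewrite (lt_le_trans fd)// ge_min lexx orbT.
  move=> le1; have := expR_sum_labels f0 psi; rewrite card_ord -expR_lnZ => psiE.
  rewrite mulrBr expRD expRN ler_pdivlMr ?expR_gt0//.
  by rewrite mulrC -psiE ler_expR.
have Tcard : expR ((d i)%:R * (ln Z - If - eta)) <= #|T|%:R.
  have half' : 2^-1 <= #|T|%:R * expR ((d i)%:R * (If + eta / 2 - ln Z)).
    apply: (le_trans half); rewrite /expect -sum1_card natr_sum mulr_suml.
    rewrite [leRHS]big_mkcond/=; apply: ler_sum => psi _.
    by case: ifPn => [/Tf|]; rewrite ?mulr1 ?mul1r ?mulr0.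
  (* The condition [d >= 2 / eta] lets the remaining [eta / 2] absorb the factor 1/2. *)
  have two : 2 <= expR ((d i)%:R * (eta / 2)).
    apply: le_trans (expR_ge1Dx _).
    have : 1 <= (d i)%:R * (eta / 2).
      by move: dge; rewrite ler_pdivrMr// => ?; lra.
    lra.
  rewrite -(@ler_pM2r _ (expR ((d i)%:R * (If + eta / 2 - ln Z)))) ?expR_gt0//.
  apply: le_trans half'; rewrite -expRD.
  rewrite (_ : _ + _ = - ((d i)%:R * (eta / 2))); last by field.
  by rewrite expRN lef_pV2 ?posrE ?expR_gt0.
apply: rate_ge => //.
apply: (@le_trans _ _ #|T|%:R%:E); first by rewrite lee_fin.
apply: le_ereal_sup_tmp; eexists.
  exists (@model _ _ _ Sigma i @` [set` T]) => //; split.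
    move=> _ [psi psiT <-]; split=> [|u uE]; first exact: modelM.
    have uE' : u \in E' by rewrite !inE uE orbT.
    have := Tdev psi [` uE']%fset psiT; rewrite /dev/= => /lt_le_trans; apply.
    by rewrite ge_min lexx.
  move=> _ _ [psi _ <-] [psi' _ <-] ne.
  apply: model_separated => //.
  by move=> EE; apply: ne; rewrite EE.
rewrite cardE -(size_map (@model _ _ _ Sigma i)); apply: counting_ge.
  by rewrite map_inj_uniq ?enum_uniq//; exact: model_inj.
move=> phi /mapP[psi]; rewrite mem_enum => psiT ->; by apply/mem_set; exists psi.
Qed.

End ProductMeasureEntropy.

(** * Equilibrium states *)

Section Equilibrium.
Variables (R : realType) (G : groupType) (L : finPointedType) (f0 : L -> R).
Hypothesis G_countable : countable [set: G].
Local Notation X := (shift_space G L).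
Local Notation Z := (partition_function f0).
Local Notation p := (gibbs_weight f0).
Local Notation f := (fun x : X => f0 (x 1%g)).

(** Reduces equality of measures on cylinders to equality of integrals of local observables with
    values 0 and 1. *)
Lemma Rintegral_cyl (mu : probability (borel X) R) (F : {fset G}) (A : G -> set L) :
  mu (cyl F A) =
  (\int[mu]_x (fun q : {ffun F -> L} =>
    [forall j, q j \in A (val j)]%:R : R) (pat F x))%:E.
Proof.
have mA := @measurable_cyl G L F A.
rewrite -[LHS]fineK ?fin_num_measure// /Rintegral; congr (fine _)%:E.
rewrite -[cyl F A]setIT -integral_indic//; apply: eq_integral => x _.
rewrite indicE; congr (_%:R%:E); congr nat_of_bool.
apply/idP/forallP => [/set_mem xA j|xA].
  by rewrite ffunE; apply/mem_set/xA/fsvalP.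
apply/mem_set => g gF; have := xA [` gF]%fset.
by rewrite ffunE => /set_mem.
Qed.

Lemma shift_cyl (g : G) (F : {fset G}) (A : G -> set L) :
  @shift_action G L g @^-1` cyl F A =
  cyl [fset g^-1 * h | h in F]%g%fset (fun k => A (g * k)%g).
Proof.
apply/seteqP; split=> x xA h.
  by move=> /imfsetP[k /= kF ->]; rewrite mulKVg; exact: xA.
by move=> hF; have := xA (g^-1 * h)%g (in_imfset _ _ hF); rewrite mulKVg.
Qed.

Lemma product_invariant (nu : probability (borel X) R) :
  (forall F A, nu (cyl F A) = (\prod_(g <- F) \sum_l p l * (l \in A g)%:R)%:E) ->
  invariant_measure (@shift_action G L) nu.
Proof.
move=> nuP g A mA.
have mg : measurable_fun setT (@shift_action G L g : borel X -> borel X).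
  apply: (measurable_into_shift G_countable (T := borel X)) => F B.
  by rewrite shift_cyl; exact: measurable_cyl.
pose gg : {mfun borel X >-> borel X} :=
  HB.pack (@shift_action G L g : borel X -> borel X) (isMeasurableFun.Build _ _ _ _ _ mg).
apply: (measure_cylinders_unique G_countable (mu := distribution nu gg)) => // F B.
rewrite [LHS](_ : _ = nu (@shift_action G L g @^-1` cyl F B))// shift_cyl !nuP.
congr (_%:E); rewrite big_imfset/=; last by move=> h k _ _; exact: mulgI.
by apply: eq_bigr => h _; rewrite mulKVg.
Qed.

(** If [x != 0], take [s = x / c] with [c] so large that both bounds on [s] hold and [c > 8 K^2].
    Then [s * x = c s^2] exceeds [8 K^2 s^2]. *)
Lemma quadratic_bound_eq0 (K x : R) : 0 <= K ->
  (forall s, `|s| <= 1 -> `|s| * K <= 4^-1 -> s * x <= 8 * (s * K) ^+ 2) -> x = 0.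
Proof.
move=> K0 sx; apply/eqP/negPn/negP => x0.
have nx : 0 < `|x| by rewrite normr_gt0.
pose c := 8 * (K + 1) ^+ 2 * (1 + `|x|).
have c0 : 0 < c by rewrite /c !mulr_gt0 ?exprn_gt0 ?ltr_wpDl//; lra.
have cx : `|x| * 4 * (K + 1) <= c by rewrite /c; nra.
have nE : `|x / c| = `|x| / c by rewrite normrM normfV (gtr0_norm c0).
have y1 : `|x / c| <= 1 by rewrite nE ler_pdivrMr// mul1r; nra.
have yK : `|x / c| * K <= 4^-1.
  by rewrite nE mulrAC ler_pdivrMr//; nra.
have := sx _ y1 yK; set y := x / c.
have -> : x = y * c by rewrite /y divfK// gt_eqF.
have y2 : 0 < y ^+ 2.
  by rewrite exprn_even_gt0//= /y mulf_neq0// invr_neq0// gt_eqF.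
have cK : 8 * K ^+ 2 < c by rewrite /c; nra.
have : 0 < y ^+ 2 * (c - 8 * K ^+ 2) by rewrite mulr_gt0// subr_gt0.
clearbody y c; nra.
Qed.

Lemma gibbsE (A : set L) :
  gibbs f0 A = (\sum_l p l * (l \in A)%:R)%:E.
Proof.
rewrite /gibbs -sumEFin; apply: eq_bigr => l _.
by rewrite diracE -EFinM.
Qed.

End Equilibrium.

Unset Implicit Arguments.

Theorem corollary3p6 (R : realType) (G : groupType) (L : finPointedType)
    (f0 : L -> R) :
  countable [set: G] -> sofic R G ->
  exists lambdaG : probability (borel (shift_space G L)) R,
    is_product_power (gibbs f0) lambdaG /\
    forall (Sigma : sofic_approximation R G)
           (rho : shift_space G L -> shift_space G L -> R),
      compatible_metric rho ->
      let f := fun x : shift_space G L => f0 (x 1%g) in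
      equilibrium_state (@shift_action G L) rho Sigma f lambdaG /\
      forall mu : probability (borel (shift_space G L)) R,
        equilibrium_state (@shift_action G L) rho Sigma f mu ->
        forall A : set (borel (shift_space G L)),
          measurable A -> mu A = lambdaG A.
Proof.
move=> G_countable _.
have [nu nuP] := product_measure_exists (gibbs_weight_gt0 f0) (gibbs_weight_sum1 f0)
  G_countable.
exists nu; split.
  move=> F A; rewrite [LHS]nuP -prodEFin; apply: eq_bigr => g _.
  by rewrite -gibbsE.
move=> Sigma rho rhoP f.
have intf (mu : probability (borel (shift_space G L)) R) :
    (\int[mu]_x (f x)%:E = (\int[mu]_x f x)%:E)%E.
  rewrite fineK//; apply: integrable_fin_num => //.
  by apply: continuous_integrable; exact: continuous_potential.
have pressureE :
    sofic_pressure (@shift_action G L) rho Sigma f = (ln (partition_function f0))%:E.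
  by apply/eqP; rewrite eq_le pressure_le//= pressure_ge.
split.
  split; first exact: product_invariant nuP.
  rewrite pressureE intf.
  have -> : sofic_entropy (@shift_action G L) rho Sigma nu =
      (ln (partition_function f0) - \int[nu]_x f x)%:E.
    apply/eqP; rewrite eq_le (entropy_ge nuP)// andbT.
    (* The bound without tilt: [s = 0] and the empty window. *)
    have n0 : `|0 : R| <= 1 by rewrite normr0.
    have k0 : `|0 : R| * #|{: (fset0 : {fset G})}|%:R <= 4^-1 by rewrite normr0 mul0r.
    have := @entropy_le _ _ _ f0 Sigma rho rhoP nu fset0 (fun=> 0) 0 (fun=> n0) n0 k0.
    by rewrite !mul0r expr0n mulr0 subr0 addr0.
  by rewrite -EFinD subrK.
move=> mu [_]; rewrite pressureE intf => muE.
(* The equilibrium equation turns the tilted entropy bound into [s] times the difference of the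
   integrals being at most [8 (s #|W|)^2], for small [s] of either sign. *)
have local_eq (W : {fset G}) (g : {ffun W -> L} -> R) : (forall q, `|g q| <= 1) ->
    \int[mu]_x g (pat W x) = \int[nu]_x g (pat W x).
  move=> g1; apply/eqP; rewrite -subr_eq0; apply/eqP.
  apply: (@quadratic_bound_eq0 _ #|{: W}|%:R) => // s s1 sW.
  have := entropy_le f0 Sigma rhoP mu g1 s1 sW.
  rewrite (product_Rintegral nuP g).
  move=> /(leeD2r (\int[mu]_x f x)%:E); rewrite -muE -EFinD lee_fin.
  lra.
apply: measure_cylinders_unique => // F A.
rewrite !Rintegral_cyl; congr (_%:E).
apply: (local_eq F (fun q => [forall j, q j \in A (val j)]%:R)) => q.
by case: forallP => _; rewrite ?normr1 ?normr0.
Qed.
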